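(* Let $T>0$ and let $a\in L^p[0,T]$, $b\in L^q[0,T]$, $c\in L^r[0,T]$, where $p\in[2,\infty]$, $q\in[1,\infty)$, $r\in[1,\infty]$ and $1/p+1/q+1/r\le\frac32$. Suppose there exist $\lambda>0$ and $C\in\mathbb{R}$ such that $$\|b\,\mathbf 1_{[0,t]}\|_q\le C\,t^\lambda\qquad\text{for all } t\in[0,T].$$ Then the stochastic process $$X_t=\int_0^t\left(a(s)\int_s^t b(u)\,c(u-s)\,du\right)dW_s,\qquad t\in[0,T],$$ has a modification which is continuous on $[0,T]$ and satisfies the Hölder condition at the point $0$ up to order $\lambda$.
   Context: $W$ is a standard Wiener process; the stochastic integral is the Wiener integral of a deterministic function; $\|\cdot\|_q$ is the $L^q$ norm. A process $\widetilde X$ satisfies the Hölder condition at the point $0$ up to order $\lambda$ if for every $\lambda_1\in(0,\lambda)$ there is a finite random variable $C_{\lambda_1}$ such that $|\widetilde X_t-\widetilde X_0|\le C_{\lambda_1}t^{\lambda_1}$ for all $t\in[0,T]$. Convention: $1/\infty=0$. *)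

(* Defs.v *)
From HB Require Import structures.
From mathcomp Require Import all_boot all_order all_algebra.
From mathcomp Require Import all_classical all_reals all_analysis.

Set Implicit Arguments.
Unset Strict Implicit.
Unset Printing Implicit Defensive.

Import Order.TTheory GRing.Theory Num.Theory.
Import numFieldNormedType.Exports.

Local Open Scope classical_set_scope.
Local Open Scope ring_scope.

(* Functions on [0, T] are total functions on R of which only the restriction
   to [0, T], extended by zero, matters. *)
Definition Lp_on (R : realType) (T : R) (p : \bar R) (f : R -> R) : Prop :=
  f \_ `[0, T] \in Lfun (@lebesgue_measure R) p.

Definition Lp_norm_on (R : realType) (T : R) (p : \bar R) (f : R -> R) : \bar R :=
  Lnorm (@lebesgue_measure R) p (EFin \o (f \_ `[0, T])).

(* The product rule for subfamilies is the case where some B i are full. *)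
Definition independent_RVs d (Omega : measurableType d) (R : realType)
    (P : probability Omega R) (n : nat) (Y : 'I_n -> Omega -> R) : Prop :=
  forall B : 'I_n -> set R, (forall i, measurable (B i)) ->
    P (\bigcap_i (Y i @^-1` B i)) = (\prod_(i < n) P (Y i @^-1` B i))%E.

(* The second parameter of [normal_prob] is the standard deviation. The value
   of W at times outside [0, T] is irrelevant. *)
Record wiener_process d (Omega : measurableType d) (R : realType)
    (P : probability Omega R) (T : R) (W : R -> {RV P >-> R}) : Prop := {
  wiener_start : \forall w \ae P, W 0 w = 0 ;
  wiener_increment : forall s t : R, 0 <= s -> s < t -> t <= T ->
    forall B : set R, measurable B ->
      P ((fun w => W t w - W s w) @^-1` B)
        = normal_prob 0 (Num.sqrt (t - s)) B ;
  wiener_independent : forall (n : nat) (t : nat -> R),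
    0 <= t 0%N -> (forall i, (i < n)%N -> t i <= t i.+1) -> t n <= T ->
    independent_RVs P (fun (i : 'I_n) w => W (t i.+1) w - W (t i) w) ;
  wiener_continuous :
    \forall w \ae P, {within `[0, T], continuous (fun t => W t w)}
}.

(* The entry (c, (l, r)) of a list h stands for c times the indicator function
   of ]l, r]. *)
Definition step_fun (R : realType) (h : seq (R * (R * R))) (x : R) : R :=
  \sum_(k <- h) k.1 * \1_(`]k.2.1, k.2.2]) x.

Definition step_within (R : realType) (T : R) (h : seq (R * (R * R))) : bool :=
  all (fun k => [&& 0 <= k.2.1, k.2.1 <= k.2.2 & k.2.2 <= T]) h.

Definition step_integral d (Omega : measurableType d) (R : realType)
    (P : probability Omega R) (W : R -> {RV P >-> R})
    (h : seq (R * (R * R))) (w : Omega) : R :=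
  \sum_(k <- h) k.1 * (W k.2.2 w - W k.2.1 w).

(* Y is a version of the Wiener integral of f over [0, T]: the L^2(P)-limit of
   the integrals of step functions converging to f in L^2[0, T]. By the Ito
   isometry, Y exists, does not depend on the approximating sequence, and is
   unique up to almost sure equality. *)
Definition is_wiener_integral d (Omega : measurableType d) (R : realType)
    (P : probability Omega R) (W : R -> {RV P >-> R}) (T : R)
    (f : R -> R) (Y : {RV P >-> R}) : Prop :=
  Lp_on T 2%:E f /\
  exists h : nat -> seq (R * (R * R)),
    [/\ forall n, step_within T (h n),
        Lp_norm_on T 2%:E (fun x => f x - step_fun (h n) x)
          @[n --> \oo] --> 0%E
      & Lnorm P 2%:E (fun w => (Y w - step_integral W (h n) w)%:E)
          @[n --> \oo] --> 0%E].

Definition inner_integrand (R : realType) (b c : R -> R) (s u : R) : R :=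
  b u * c (u - s).

Definition volterra_kernel (R : realType) (a b c : R -> R) (t s : R) : R :=
  a s * Rintegral (@lebesgue_measure R) `[s, t] (inner_integrand b c s).

(* [Rintegral] is total, so convergence of the inner integrals is stated
   separately. *)
Definition kernel_well_defined (R : realType) (a b c : R -> R) (t : R) : Prop :=
  (\forall s \ae (@lebesgue_measure R), 0 <= s <= t ->
     (@lebesgue_measure R).-integrable `[s, t] (EFin \o inner_integrand b c s)) /\
  Lp_on t 2%:E (volterra_kernel a b c t).

Definition modification d (Omega : measurableType d) (R : realType)
    (P : probability Omega R) (T : R) (X Xt : R -> {RV P >-> R}) : Prop :=
  forall t, 0 <= t <= T -> P [set w | X t w = Xt t w] = 1%E.

Definition holder_at_zero_up_to d (Omega : measurableType d) (R : realType)
    (P : probability Omega R) (T lambda : R) (X : R -> {RV P >-> R}) : Prop :=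
  forall lambda1, 0 < lambda1 < lambda ->
    exists C1 : {RV P >-> R}, forall w t, 0 <= t <= T ->
      `|X t w - X 0 w| <= C1 w * t `^ lambda1.

(* Main.v *)
(* A Volterra kernel with a in L^p, b in L^q and c in L^r has
     || a (b 1_]s,t] * c~) ||_2 <= K || b 1_]s,t] ||_q,  c~ x = c (- x),
   a Young inequality on a bounded interval, which is where
   1/p + 1/q + 1/r <= 3/2 enters. Hence E |X_t - X_s|^2 <= K^2 N^2 with
   N^q = \int_s^t |b|^q. As X_t - X_s is a limit of Gaussian variables, its tails
   are at least exponential at the scale N. In the clock
   F t = \int_0^t |b|^q + t^n the process therefore satisfies the hypotheses of
   the Kolmogorov-Chentsov theorem with exponent 1/q, which gives a continuous
   modification, Holder in F t of every order below 1/q; at the origin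
   F t <= c t^(lambda q), so this is every order below lambda in t. *)
Require Import Defs.
From HB Require Import structures.
From mathcomp Require Import all_boot all_order all_algebra.
From mathcomp Require Import all_classical all_reals all_analysis.
From mathcomp Require Import measurable_realfun ring lra.

Set Implicit Arguments.
Unset Strict Implicit.
Unset Printing Implicit Defensive.

Import Order.TTheory GRing.Theory Num.Theory.
Import numFieldNormedType.Exports.

Local Open Scope classical_set_scope.
Local Open Scope ring_scope.

(** * Invariance of Lebesgue measure and the L2 norm *)

(** The variance bound alone would not give continuity. In the normalised clock it reads
    [E |Z_y - Z_x|^2 <= c |y - x|^(2/q)], and a moment criterion needs an exponent above 1, which
    fails for q >= 2. Exponential tails have the same shape at every distance and yield every order
    below 1/q. They come from Chernoff's bound at one fixed parameter for step functions and pass to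
    L^2 limits by Chebyshev's inequality, so the law of the limit never has to be identified. The
    exponents satisfy only an inequality, and p and r may be infinite, so Young's inequality with
    balanced exponents does not apply as it stands. Each function is therefore dominated by a
    constant times a power of an integrable weight with values in {0} and [1, oo[. Powers of such a
    weight increase with the exponent, so slack in the exponents is harmless, and an infinite index
    simply becomes the exponent 0. *)

Section lebesgue_invariance.
Context {R : realType}.
Local Notation mu := (@lebesgue_measure R).

Definition translate (c : R) (x : measurableTypeR R) : measurableTypeR R := (x + c)%R.
Definition reflect_at (c : R) (x : measurableTypeR R) : measurableTypeR R := (c - x)%R.

Lemma measurable_translate (c : R) : measurable_fun setT (translate c).
Proof. exact: measurable_funD. Qed.

Lemma measurable_reflect_at (c : R) : measurable_fun setT (reflect_at c).
Proof. exact: measurable_funB. Qed.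

HB.instance Definition _ (c : R) :=
  @isMeasurableFun.Build _ _ _ _ (translate c) (measurable_translate c).

HB.instance Definition _ (c : R) :=
  @isMeasurableFun.Build _ _ _ _ (reflect_at c) (measurable_reflect_at c).

Lemma lebesgue_measure_shift (c : R) (A : set R) : measurable A ->
  pushforward mu (translate c) A
  = mu A.
Proof.
move=> mA; apply/esym/lebesgue_measure_unique => //= _ [[a b]] _ <-.
rewrite /pushforward.
have -> : translate c @^-1` `]a, b] = `]a - c, b - c]%classic.
  by apply/seteqP; split => x /=; rewrite !in_itv/= ltrBlDr lerBrDr.
rewrite !lebesgue_measure_itv/= !lte_fin ltrD2r -!EFinB.
by case: ifPn => // _; congr EFin; ring.
Qed.

Lemma lebesgue_measure_reflect (c : R) (A : set R) : measurable A ->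
  pushforward mu (reflect_at c) A
  = mu A.
Proof.
move=> mA; apply/esym/lebesgue_measure_unique => //= _ [[a b]] _ <-.
rewrite /pushforward.
have -> : reflect_at c @^-1` `]a, b] = `[c - b, c - a[%classic.
  have E (x : R) : (a < c - x <= b) = (c - b <= x < c - a).
    by rewrite andbC lerBlDr ltrBrDr addrC -lerBlDr ltrBrDl.
  by apply/seteqP; split => x /=; rewrite !in_itv/= /reflect_at E.
rewrite !lebesgue_measure_itv/= !lte_fin ltrD2l ltrN2 -!EFinB.
by case: ifPn => // _; congr EFin; ring.
Qed.

Local Open Scope ereal_scope.

Lemma ge0_integral_shift (c : R) (f : R -> \bar R) :
  measurable_fun [set: R] f -> (forall x, 0 <= f x) ->
  \int[mu]_x f (x + c)%R = \int[mu]_x f x.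
Proof.
move=> mf f0.
transitivity (\int[pushforward mu (translate c)]_x f x).
  by rewrite ge0_integral_pushforward//= preimage_setT.
by apply: eq_measure_integral => A mA _; exact: lebesgue_measure_shift.
Qed.

Lemma ge0_integral_reflect (c : R) (f : R -> \bar R) :
  measurable_fun [set: R] f -> (forall x, 0 <= f x) ->
  \int[mu]_x f (c - x)%R = \int[mu]_x f x.
Proof.
move=> mf f0.
transitivity (\int[pushforward mu (reflect_at c)]_x f x).
  by rewrite ge0_integral_pushforward//= preimage_setT.
by apply: eq_measure_integral => A mA _; exact: lebesgue_measure_reflect.
Qed.

Lemma ae_shift (c : R) (Q : R -> Prop) :
  {ae mu, forall x, Q x} -> {ae mu, forall x, Q (x + c)%R}.
Proof.
move=> [N [mN N0 QN]].
exists (translate c @^-1` N); split.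
- rewrite -[X in measurable X]setTI; exact: measurable_translate.
- by have := lebesgue_measure_shift c mN; rewrite /pushforward N0.
- by move=> x /= nQ; apply: QN.
Qed.

End lebesgue_invariance.

Section L2_norm.
Context d (T : measurableType d) {R : realType}.
Variable mu : {measure set T -> \bar R}.
Local Open Scope ereal_scope.

Lemma sqr_Lnorm2 (h : T -> R) :
  'N[mu]_2%:E[EFin \o h] * 'N[mu]_2%:E[EFin \o h] = \int[mu]_x (h x ^+ 2)%:E.
Proof.
have n2 : (2 != 0 :> R)%R by rewrite pnatr_eq0.
have := @poweR_Lnorm _ _ _ mu (EFin \o h) 2 n2.
rewrite {2}(_ : 2%R = 1 + 1)%R; last by ring.
rewrite poweRD ?poweRe1 ?Lnorm_ge0//; last first.
  by rewrite /poweRD_def -(_ : 2%R = 1 + 1)%R ?(negPf n2)//; ring.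
move=> ->; apply: eq_integral => x _ /=.
by rewrite powR_mulrn// real_normK// num_real.
Qed.

(** Cauchy-Schwarz in squared form, so that no root of a possibly infinite integral is taken. *)
Lemma sqr_integralM_le (f g : T -> R) :
  measurable_fun [set: T] f -> measurable_fun [set: T] g ->
  (forall x, 0 <= f x)%R -> (forall x, 0 <= g x)%R ->
  (\int[mu]_x (f x * g x)%:E) * (\int[mu]_x (f x * g x)%:E) <=
  (\int[mu]_x (f x ^+ 2)%:E) * (\int[mu]_x (g x ^+ 2)%:E).
Proof.
move=> mf mg f0 g0.
have := @hoelder _ _ _ mu _ _ 2 2 mf mg (ltr0n _ 2) (ltr0n _ 2).
have -> : (2^-1 + 2^-1 = 1 :> R)%R by field.
move=> /(_ erefl); rewrite Lnorm1 => H.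
have -> : \int[mu]_x (f x * g x)%:E = \int[mu]_x `|(EFin \o (f \* g)%R) x|.
  by apply: eq_integral => x _ /=; rewrite ger0_norm ?mulr_ge0.
rewrite -!sqr_Lnorm2 muleACA.
by apply: lee_pmul => //; exact: integral_ge0.
Qed.

End L2_norm.

(** * A Young inequality on weights bounded below by one *)

Section gpow.
Context {R : realType}.
Implicit Types x y s t : R.

(* [powR] has [0 `^ 0 = 1]; sending [0] to [0] makes [gpowD] unconditional. *)
Definition gpow x s : R := if x == 0 then 0 else x `^ s.

(** On these values [gpow] is monotone in the exponent ([ler_gpow]), so exponents may be raised
    freely. This replaces the exact balance of exponents in Young's inequality. *)
Definition zero_or_ge1 x := x = 0 \/ 1 <= x.

Lemma gpow_ge0 x s : 0 <= gpow x s.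
Proof. by rewrite /gpow; case: ifPn => // _; exact: powR_ge0. Qed.

Lemma gpow0 s : gpow 0 s = 0.
Proof. by rewrite /gpow eqxx. Qed.

Lemma gpowD x s t : gpow x (s + t) = gpow x s * gpow x t.
Proof.
rewrite /gpow; case: ifPn => [_|x0]; first by rewrite mul0r.
by rewrite powRD// x0 implybT.
Qed.

Lemma gpow1 x : 0 <= x -> gpow x 1 = x.
Proof. by rewrite /gpow; case: eqP => [->//|_ x0]; rewrite powRr1. Qed.

Lemma zero_or_ge1_ge0 x : zero_or_ge1 x -> 0 <= x.
Proof. by case=> [->//|]; exact: le_trans. Qed.

Lemma ler_gpow x s t : zero_or_ge1 x -> s <= t -> gpow x s <= gpow x t.
Proof.
move=> [->|x1] st; first by rewrite !gpow0.
by rewrite /gpow gt_eqF ?(lt_le_trans _ x1)//; exact: ler_powR.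
Qed.

(** If both weights are at least [1], then with [m = max x y] the product is at most m^(s + t),
    hence at most [m]. This stands in for the weighted arithmetic-geometric mean inequality when
    [s + t < 1]. *)
Lemma gpowM_le x y s t : zero_or_ge1 x -> zero_or_ge1 y ->
  0 <= s -> 0 <= t -> s + t <= 1 -> gpow x s * gpow y t <= x + y.
Proof.
move=> hx hy s0 t0 st.
have [x0 y0] := (zero_or_ge1_ge0 hx, zero_or_ge1_ge0 hy).
case: (hx) => [->|x1]; first by rewrite gpow0 mul0r add0r.
case: (hy) => [->|y1]; first by rewrite gpow0 mulr0 addr0.
pose m := Num.max x y.
have m1 : 1 <= m by rewrite /m le_max x1.
have m0 : 0 <= m by exact: le_trans m1.
apply: (@le_trans _ _ (m `^ s * m `^ t)).
  rewrite /gpow !gt_eqF ?(lt_le_trans _ x1) ?(lt_le_trans _ y1)//.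
  by apply: ler_pM; rewrite ?powR_ge0// ge0_ler_powR ?nnegrE// /m le_max lexx// orbT.
have mgt0 : 0 < m by exact: lt_le_trans m1.
rewrite -powRD; last by rewrite (gt_eqF mgt0) implybT.
apply: (@le_trans _ _ (m `^ 1)); first exact: ler_powR.
by rewrite powRr1// /m ge_max lerDl y0 lerDr x0.
Qed.

Lemma measurable_gpow s : measurable_fun setT (gpow ^~ s).
Proof.
rewrite /gpow; apply: measurable_fun_if => //.
- by apply: measurable_fun_eqr => //; exact: measurable_cst.
- by apply: measurable_funTS; exact: measurable_powR.
Qed.

End gpow.

(** The convolution of B^b with the reflection of C^c, in extended reals so that it can be estimated
    before it is known to be finite. *)
Definition gpow_conv {R : realType} (B C : R -> R) (b c s : R) : \bar R :=
  (\int[@lebesgue_measure R]_u (gpow (B u) b * gpow (C (u - s)) c)%:E)%E.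

(** * Trilinear integral bounds for weights *)

Section trilinear.
Context {R : realType}.
Local Notation mu := (@lebesgue_measure R).
Variables A B C : R -> R.
Hypotheses (mA : measurable_fun setT A) (mB : measurable_fun setT B)
  (mC : measurable_fun setT C).
Hypotheses (hA : forall x, zero_or_ge1 (A x)) (hB : forall x, zero_or_ge1 (B x))
  (hC : forall x, zero_or_ge1 (C x)).
Local Open Scope ereal_scope.

Let I (f : R -> R) := \int[mu]_x (f x)%:E.

Lemma integral_weight_ge0 f : (forall x, zero_or_ge1 (f x)) -> 0 <= I f.
Proof.
by move=> h; apply: integral_ge0 => x _; rewrite lee_fin zero_or_ge1_ge0.
Qed.

Lemma integral_weight_shift (c : R) (f : R -> R) :
  measurable_fun setT f -> (forall x, zero_or_ge1 (f x)) ->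
  \int[mu]_x (f (x + c)%R)%:E = I f.
Proof.
move=> mf hf; rewrite (ge0_integral_shift c (f := EFin \o f))//.
  exact/measurable_EFinP.
by move=> x /=; rewrite lee_fin zero_or_ge1_ge0.
Qed.

Lemma integral_weight_reflect (c : R) (f : R -> R) :
  measurable_fun setT f -> (forall x, zero_or_ge1 (f x)) ->
  \int[mu]_x (f (c - x)%R)%:E = I f.
Proof.
move=> mf hf; rewrite (ge0_integral_reflect c (f := EFin \o f))//.
  exact/measurable_EFinP.
by move=> x /=; rewrite lee_fin zero_or_ge1_ge0.
Qed.

Lemma integral_gpowM_le (f g : R -> R) (s t : R) :
  measurable_fun setT f -> measurable_fun setT g ->
  (forall x, zero_or_ge1 (f x)) -> (forall x, zero_or_ge1 (g x)) ->
  (0 <= s)%R -> (0 <= t)%R -> (s + t <= 1)%R ->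
  \int[mu]_x (gpow (f x) s * gpow (g x) t)%:E <= I f + I g.
Proof.
move=> mf mg hf hg s0 t0 st.
rewrite -ge0_integralD//=; try by [move=> x _; rewrite lee_fin zero_or_ge1_ge0
  | exact/measurable_EFinP].
apply: ge0_le_integral => //=.
- by move=> x _; rewrite lee_fin mulr_ge0 ?gpow_ge0.
- apply/measurable_EFinP; apply: measurable_funM.
    exact: (measurableT_comp (measurable_gpow s) mf).
  exact: (measurableT_comp (measurable_gpow t) mg).
- by apply: emeasurable_funD; exact/measurable_EFinP.
- by move=> x _; rewrite -EFinD lee_fin gpowM_le.
Qed.

Lemma measurable_gpow_conv_integrand b c : measurable_fun setT
  (fun z : measurableTypeR R * measurableTypeR R =>
     (gpow (B z.2) b * gpow (C (z.2 - z.1)) c)%:E).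
Proof.
apply/measurable_EFinP; apply: measurable_funM.
  exact: (measurableT_comp (measurable_gpow b)
    (measurableT_comp mB measurable_snd)).
apply: (measurableT_comp (measurable_gpow c)).
apply: (measurableT_comp mC); apply: measurable_funB.
  exact: measurable_snd.
exact: measurable_fst.
Qed.

Lemma measurable_gpow_conv b c : measurable_fun [set: R] (gpow_conv B C b c).
Proof.
apply: (measurable_fun_fubini_tonelli_F (m2 := mu) _ (measurable_gpow_conv_integrand b c)) => x.
by rewrite lee_fin mulr_ge0 ?gpow_ge0.
Qed.

Lemma gpow_conv_ge0 b c s : 0 <= gpow_conv B C b c s.
Proof. by apply: integral_ge0 => u _; rewrite lee_fin mulr_ge0 ?gpow_ge0. Qed.

Let mAC a c : measurable_fun setT
  (fun z : measurableTypeR R * measurableTypeR R =>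
     (gpow (A z.1) a * gpow (C (z.2 - z.1)) c)%:E).
Proof.
apply/measurable_EFinP; apply: measurable_funM.
  exact: (measurableT_comp (measurable_gpow a)
    (measurableT_comp mA measurable_fst)).
apply: (measurableT_comp (measurable_gpow c)).
apply: (measurableT_comp mC); apply: measurable_funB.
  exact: measurable_snd.
exact: measurable_fst.
Qed.

Lemma trilinear_swap a b c :
  \int[mu]_s ((gpow (A s) a)%:E *
    gpow_conv B C b c s) =
  \int[mu]_u ((gpow (B u) b)%:E *
    \int[mu]_s (gpow (A s) a * gpow (C (u - s)) c)%:E).
Proof.
transitivity (\int[mu]_s \int[mu]_u
    (gpow (A s) a * (gpow (B u) b * gpow (C (u - s)) c))%:E).
  apply: eq_integral => s _; rewrite -ge0_integralZl//=.
  - exact: (measurable_fun_pair2 s (measurable_gpow_conv_integrand b c)).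
  - by move=> u _; rewrite lee_fin mulr_ge0 ?gpow_ge0.
  - by rewrite lee_fin gpow_ge0.
rewrite (@fubini_tonelli _ _ _ _ _ mu mu (fun z => (gpow (A z.1) a *
   (gpow (B z.2) b * gpow (C (z.2 - z.1)) c))%:E)); last 2 first.
- apply/measurable_EFinP; apply: measurable_funM.
    exact: (measurableT_comp (measurable_gpow a)
      (measurableT_comp mA measurable_fst)).
  by apply/measurable_EFinP; exact: measurable_gpow_conv_integrand.
- by move=> z; rewrite lee_fin !mulr_ge0 ?gpow_ge0.
apply: eq_integral => u _.
have mf : measurable_fun [set: R]
    (fun s : R => (gpow (A s) a * gpow (C (u - s)) c)%:E).
  apply/measurable_EFinP; apply: measurable_funM.
    exact: (measurableT_comp (measurable_gpow a) mA).
  apply: (measurableT_comp (measurable_gpow c)).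
  exact: (measurableT_comp mC (measurable_reflect_at u)).
rewrite -(ge0_integralZl mu measurableT mf); last 2 first.
- by move=> s _; rewrite lee_fin mulr_ge0 ?gpow_ge0.
- by rewrite lee_fin gpow_ge0.
by apply: eq_integral => s _; rewrite -EFinM; congr EFin; rewrite /= mulrCA.
Qed.

(** After [trilinear_swap] the inner integral over [s] has two factors with exponents of sum at most
    [1]. It is at most [I A + I C] uniformly in [u], because Lebesgue measure is invariant under
    reflection at [u]. *)
Lemma trilinear_le1 a c : (0 <= a)%R -> (0 <= c)%R -> (a + c <= 1)%R ->
  \int[mu]_s ((gpow (A s) a)%:E *
    gpow_conv B C 1 c s) <= I B * (I A + I C).
Proof.
move=> a0 c0 ac; rewrite trilinear_swap.
rewrite /I -ge0_integralZr//; last 3 first.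
- exact/measurable_EFinP.
- by move=> u _; rewrite lee_fin zero_or_ge1_ge0.
- by rewrite adde_ge0 ?integral_weight_ge0.
apply: ge0_le_integral => //=.
- move=> u _; rewrite mule_ge0// ?lee_fin ?gpow_ge0//.
  by apply: integral_ge0 => s _; rewrite lee_fin mulr_ge0 ?gpow_ge0.
- apply: emeasurable_funM.
    apply/measurable_EFinP; exact: (measurableT_comp (measurable_gpow 1) mB).
  apply: (measurable_fun_fubini_tonelli_G (m1 := mu) _ (mAC a c)) => x.
  by rewrite lee_fin mulr_ge0 ?gpow_ge0.
- by apply: emeasurable_funM => //; exact/measurable_EFinP.
- move=> u _; rewrite gpow1 ?zero_or_ge1_ge0// lee_wpmul2l//.
    by rewrite lee_fin zero_or_ge1_ge0.
  rewrite -[X in _ + X](integral_weight_reflect u mC hC).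
  apply: (@integral_gpowM_le A (fun s => C (u - s)%R)) => //.
  exact: (measurableT_comp mC (measurable_reflect_at u)).
Qed.

End trilinear.

Section trilinear_bound.
Context {R : realType}.
Local Notation mu := (@lebesgue_measure R).
Variables A B C : R -> R.
Hypotheses (mA : measurable_fun setT A) (mB : measurable_fun setT B)
  (mC : measurable_fun setT C).
Hypotheses (hA : forall x, zero_or_ge1 (A x)) (hB : forall x, zero_or_ge1 (B x))
  (hC : forall x, zero_or_ge1 (C x)).
Local Open Scope ereal_scope.

Let I (f : R -> R) := \int[mu]_x (f x)%:E.

Let mBC := measurable_gpow_conv_integrand mB mC.
Let mconv b c := measurable_gpow_conv mB mC b c.
Let conv_ge0 := gpow_conv_ge0 B C.

Let msq a b c : measurable_fun [set: R]
  (fun s : R => (gpow (A s) a)%:E * (gpow_conv B C b c s * gpow_conv B C b c s)).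
Proof.
apply: emeasurable_funM; last by apply: emeasurable_funM; exact: mconv.
by apply/measurable_EFinP; exact: (measurableT_comp (measurable_gpow a) mA).
Qed.

Let mA_gpow a : measurable_fun [set: R] (fun s : R => (gpow (A s) a)%:E).
Proof. by apply/measurable_EFinP; exact: (measurableT_comp (measurable_gpow a) mA). Qed.

(* The substitution [u = w + s] followed by [s := - s] exchanges the roles of
   [B] and [C]. *)
Lemma trilinear_le2 a b : (0 <= a)%R -> (0 <= b)%R -> (a + b <= 1)%R ->
  \int[mu]_s ((gpow (A s) a)%:E *
    gpow_conv B C b 1 s) <= I C * (I A + I B).
Proof.
move=> a0 b0 ab.
have mA' : measurable_fun setT (fun s : R => A (0 - s))%R.
  exact: (measurableT_comp mA (measurable_reflect_at 0)).
have := trilinear_le1 mA' mC mB (fun x => hA _) hC hB a0 b0 ab.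
rewrite (integral_weight_reflect 0 mA hA); apply: le_trans.
pose h s := (gpow (A s) a)%:E *
  gpow_conv B C b 1 s.
have mh : measurable_fun [set: R] h by exact: emeasurable_funM.
have h0 s : 0 <= h s by rewrite mule_ge0// lee_fin gpow_ge0.
rewrite -[leLHS](ge0_integral_reflect 0%R mh h0) le_eqVlt.
apply/orP; left; apply/eqP.
apply: eq_integral => s _; rewrite /h; congr (mule (_%:E)).
rewrite -[LHS](ge0_integral_shift (- s)%R); last 2 first.
- apply: (measurable_fun_pair2 (0 - s)%R (mBC b 1)).
- by move=> u; rewrite lee_fin mulr_ge0 ?gpow_ge0.
apply: eq_integral => u _; congr EFin; rewrite mulrC.
by rewrite sub0r opprK subrK.
Qed.

(** The exponents are split as [b = x + (b - x)] and [c = y + (c - y)], and Cauchy-Schwarz is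
    applied in [u]. The second factor is at most [I B + I C] for every [s], which leaves a form
    linear in the convolution, with doubled exponents. *)
Lemma trilinear_cauchy_schwarz a b c x y (M : \bar R) : 0 <= M ->
  (0 <= b - x)%R -> (0 <= c - y)%R -> ((b - x) *+ 2 + (c - y) *+ 2 <= 1)%R ->
  \int[mu]_s ((gpow (A s) a)%:E *
    gpow_conv B C (x *+ 2) (y *+ 2) s) <= M ->
  \int[mu]_s ((gpow (A s) a)%:E *
    ((gpow_conv B C b c s) *
     (gpow_conv B C b c s))) <= M * (I B + I C).
Proof.
move=> M0 bx cy bcxy HM.
apply: (@le_trans _ _ ((\int[mu]_s ((gpow (A s) a)%:E *
  gpow_conv B C (x *+ 2) (y *+ 2) s))
   * (I B + I C))); last first.
  by apply: lee_wpmul2r => //; rewrite adde_ge0 ?integral_weight_ge0.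
have mh : measurable_fun [set: R] (fun s : R => (gpow (A s) a)%:E *
    gpow_conv B C (x *+ 2) (y *+ 2) s).
  exact: emeasurable_funM.
rewrite -(ge0_integralZr mu measurableT mh); last 2 first.
- by move=> s _; rewrite mule_ge0// lee_fin gpow_ge0.
- by rewrite adde_ge0 ?integral_weight_ge0.
apply: ge0_le_integral => //.
- by move=> s _; rewrite !mule_ge0// lee_fin gpow_ge0.
- exact: msq.
- by apply: emeasurable_funM => //; exact: measurable_cst.
move=> s _; rewrite -muleA; apply: lee_wpmul2l; first by rewrite lee_fin gpow_ge0.
pose f u := (gpow (B u) x * gpow (C (u - s)) y)%R.
pose g u := (gpow (B u) (b - x) * gpow (C (u - s)) (c - y))%R.
have mfg b' c' : measurable_fun [set: R]
    (fun u : R => (gpow (B u) b' * gpow (C (u - s)) c')%R).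
  by apply/measurable_EFinP; exact: (measurable_fun_pair2 s (mBC b' c')).
have -> : gpow_conv B C b c s =
    \int[mu]_u (f u * g u)%:E.
  apply: eq_integral => u _; congr EFin; rewrite /f /g.
  by rewrite -{1}(subrKC x b) -{1}(subrKC y c) !gpowD mulrACA.
apply: (le_trans (sqr_integralM_le mu _ _ _ _)).
- exact: mfg.
- exact: mfg.
- by move=> u; rewrite mulr_ge0 ?gpow_ge0.
- by move=> u; rewrite mulr_ge0 ?gpow_ge0.
apply: lee_pmul; try by apply: integral_ge0 => u _; rewrite lee_fin sqr_ge0.
  rewrite le_eqVlt; apply/orP; left; apply/eqP; apply: eq_integral => u _.
  by congr EFin; rewrite /f !mulr2n !gpowD expr2 mulrACA.
rewrite -[X in _ <= _ + X](integral_weight_shift (- s) mC hC).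
apply: le_trans (integral_gpowM_le (s := (b - x) *+ 2) (t := (c - y) *+ 2)
  mB _ hB _ _ _ _) => //.
- rewrite le_eqVlt; apply/orP; left; apply/eqP; apply: eq_integral => u _.
  by congr EFin; rewrite /g !(mulr2n (_ - _)) !gpowD expr2 mulrACA.
- exact: (measurableT_comp mC (measurable_translate _)).
- by rewrite mulrn_wge0.
- by rewrite mulrn_wge0.
Qed.

(** Splitting off [x = 1/2] or [y = 1/2] in [trilinear_cauchy_schwarz] brings one doubled exponent
    to [1], the situation of [trilinear_le1] or [trilinear_le2]. The two summands on the right
    belong to these two cases. *)
Lemma trilinear_bound (a b c : R) :
  (0 <= a <= 1/2)%R -> (0 <= b <= 1)%R -> (0 <= c <= 1)%R -> (a + b + c <= 3/2)%R ->
  \int[mu]_s ((gpow (A s) (a *+ 2))%:E *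
    ((gpow_conv B C b c s) *
     (gpow_conv B C b c s))) <=
  (I B * (I A + I C) + I C * (I A + I B)) * (I B + I C).
Proof.
move=> /andP[a0 a1] /andP[b0 b1] /andP[c0 c1] abc.
have [IA IB IC] : [/\ 0 <= I A, 0 <= I B & 0 <= I C] by split; exact: integral_weight_ge0.
have [c2|c2] := leP c (1/2)%R.
  (* Splitting off [1/2] requires [1/2 <= b]. A smaller exponent is raised to [1/2]: this only
     enlarges the convolution, and the sum stays within [3/2] since [a] and [c] are at most
     [1/2]. *)
  pose b' : R := Num.max b (1/2)%R.
  have b'b : (b <= b')%R by rewrite le_max lexx.
  have [b'1 b'2 b'3] : [/\ 1/2 <= b', b' <= 1 & a + b' + c <= 3/2]%R.
    by rewrite /b'; case: (leP b (1/2)%R) => ?; split; lra.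
  (* The largest [y <= c] with [a *+ 2 + y *+ 2 <= 1], as [trilinear_le1] demands. If it is
     [1/2 - a], the condition on the remaining exponents is exactly [a + b' + c <= 3/2]. *)
  pose y : R := Num.min c (1/2 - a)%R.
  have [y0 y1 y2 y3] : [/\ 0 <= y, y <= c, y <= 1/2 - a &
      (b' - 1/2) *+ 2 + (c - y) *+ 2 <= 1]%R.
    by rewrite /y; case: (leP c (1/2 - a)%R) => ?; split; lra.
  apply: (@le_trans _ _ (I B * (I A + I C) * (I B + I C))); last first.
    by apply: lee_wpmul2r; [exact: adde_ge0|rewrite leeDl// mule_ge0// adde_ge0].
  apply: (@le_trans _ _ (\int[mu]_s ((gpow (A s) (a *+ 2))%:E *
    ((gpow_conv B C b' c s) *
     (gpow_conv B C b' c s))))).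
    apply: ge0_le_integral; first exact: measurableT.
    - by move=> s _; rewrite !mule_ge0// lee_fin gpow_ge0.
    - exact: msq.
    - exact: msq.
    move=> s _; apply: lee_wpmul2l; first by rewrite lee_fin gpow_ge0.
    have H : gpow_conv B C b c s <=
        gpow_conv B C b' c s.
      apply: ge0_le_integral => //.
      - by move=> u _; rewrite lee_fin mulr_ge0 ?gpow_ge0.
      - exact: (measurable_fun_pair2 s (mBC b c)).
      - exact: (measurable_fun_pair2 s (mBC b' c)).
      - by move=> u _; rewrite lee_fin ler_wpM2r ?gpow_ge0 ?ler_gpow.
    by apply: lee_pmul; [exact: conv_ge0|exact: conv_ge0|exact: H|exact: H].
  apply: (@trilinear_cauchy_schwarz _ _ _ (1/2)%R y);
    [by rewrite mule_ge0// adde_ge0|lra|lra|lra|].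
  rewrite (_ : (1/2) *+ 2 = 1)%R; last by field.
  by apply: trilinear_le1 => //; rewrite ?mulr2n; lra.
(* The mirror case: [1/2 < c] holds already, so no exponent has to be raised. *)
pose x : R := Num.min b (1/2 - a)%R.
have [x0 x1 x2 x3] : [/\ 0 <= x, x <= b, x <= 1/2 - a &
    (b - x) *+ 2 + (c - 1/2) *+ 2 <= 1]%R.
  by rewrite /x; case: (leP b (1/2 - a)%R) => ?; split; lra.
apply: (@le_trans _ _ (I C * (I A + I B) * (I B + I C))); last first.
  by apply: lee_wpmul2r; [exact: adde_ge0|rewrite leeDr// mule_ge0// adde_ge0].
apply: (@trilinear_cauchy_schwarz _ _ _ x (1/2)%R);
  [by rewrite mule_ge0// adde_ge0|lra|lra|lra|].
rewrite (_ : (1/2) *+ 2 = 1)%R; last by field.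
by apply: trilinear_le2 => //; rewrite ?mulr2n; lra.
Qed.

End trilinear_bound.

(** * Dominating weights for functions in L^p *)

Section Lebesgue_dominants.
Context {R : realType}.
Local Notation mu := (@lebesgue_measure R).

Lemma indic_itvcc1 (T x : R) : 0 <= x <= T -> \1_(`[0, T]) x = 1 :> R.
Proof. by move=> xT; rewrite indicE mem_set//= in_itv. Qed.

Lemma indic_itvcc0 (T x : R) : ~ 0 <= x <= T -> \1_(`[0, T]) x = 0 :> R.
Proof. by move=> xT; rewrite indicE memNset//= in_itv. Qed.

(** The weight is 1 + |f|^q / N^q on [[0, T]] and [0] elsewhere. Its integral is at most [T + 1]
    whatever [f] and [N] are, so the size of [f] enters only through the factor [N]. *)
Lemma gpow_dominant_fin (T q N : R) (f : R -> R) :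
  0 < T -> 1 <= q -> 0 < N -> measurable_fun setT f ->
  (forall x, ~ 0 <= x <= T -> f x = 0) ->
  (\int[mu]_x (`|f x| `^ q)%:E <= (N `^ q)%:E)%E ->
  exists B : R -> R, [/\ measurable_fun setT B, forall x, zero_or_ge1 (B x),
    (\int[mu]_x (B x)%:E <= (T + 1)%:E)%E &
    forall x, `|f x| <= N * gpow (B x) q^-1].
Proof.
move=> T0 q1 N0 mf f0 fN.
have q0 : 0 < q by exact: lt_le_trans q1.
have mfq : measurable_fun [set: R] (fun x => `|f x| `^ q).
  apply: (measurableT_comp (measurable_powR q)).
  exact: measurableT_comp.
pose g x := (N `^ q)^-1 * `|f x| `^ q.
have mg : measurable_fun [set: R] g by exact: measurable_funM.
have g0 x : 0 <= g x by rewrite mulr_ge0 ?invr_ge0 ?powR_ge0.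
have gE x : ~ 0 <= x <= T -> g x = 0.
  by move=> /f0; rewrite /g => ->; rewrite normr0 powR0 ?mulr0// gt_eqF.
exists (fun x => \1_(`[0, T]) x + g x); split.
- by apply: measurable_funD => //; exact: measurable_indic.
- move=> x; have [xT|xT] := pselect (0 <= x <= T).
    by right; rewrite indic_itvcc1// lerDl.
  by left; rewrite gE// indic_itvcc0// addr0.
- under eq_integral do rewrite EFinD.
  rewrite ge0_integralD//=.
  all: try by [move=> *; rewrite lee_fin | apply/measurable_EFinP; exact: measurable_indic | exact/measurable_EFinP].
  rewrite integral_indic//= setIT lebesgue_measure_itv/= lte_fin T0 sube0 EFinD.
  apply: leeD => //; under eq_integral do rewrite EFinM.
  rewrite ge0_integralZl//=.
  all: try by [exact/measurable_EFinP | move=> *; rewrite lee_fin powR_ge0 | rewrite lee_fin invr_ge0 powR_ge0].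
  have Nq : 0 < N `^ q by rewrite powR_gt0.
  rewrite muleC lee_pdivrMr// mul1e.
  exact: fN.
- move=> x; have [xT|xT] := pselect (0 <= x <= T); last first.
    by rewrite f0// normr0 mulr_ge0 ?gpow_ge0// ltW.
  rewrite indic_itvcc1//.
  rewrite /gpow gt_eqF; last by rewrite ltr_pwDl.
  have -> : `|f x| = N * (g x `^ q^-1).
    rewrite /g powRM ?invr_ge0 ?powR_ge0// -powRN -!powRrM mulfV ?gt_eqF//.
    rewrite powRr1// mulNr mulfV ?gt_eqF// powRN powRr1 ?ltW//.
    by rewrite mulrA mulfV ?gt_eqF// mul1r.
  rewrite ler_pM2l// ge0_ler_powR ?nnegrE ?invr_ge0 ?addr_ge0//; [exact: ltW|].
  by rewrite lerDr.
Qed.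

(** For [p = +oo] the weight is the indicator of [[0, T]] with exponent [0], and the bound by the
    essential supremum holds only almost everywhere. *)
Lemma gpow_dominant (T : R) (p : \bar R) (f : R -> R) :
  0 < T -> (1 <= p)%E -> Lp_on T p f ->
  exists B : R -> R, exists N : R, [/\ measurable_fun setT B,
    forall x, zero_or_ge1 (B x), (\int[mu]_x (B x)%:E < +oo)%E, 0 <= N &
    {ae mu, forall x, `|(f \_ `[0, T]) x| <= N * gpow (B x) (fine p^-1)}].
Proof.
move=> T0 p1; rewrite /Lp_on => fL.
have mf' : measurable_fun setT (f \_ `[0, T]).
  by have := sub_Lfun_mfun fL; rewrite inE.
have := sub_Lfun_finLfun fL; rewrite inE /= /finite_norm => fN.
have f0 x : ~ 0 <= x <= T -> (f \_ `[0, T]) x = 0.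
  by move=> xT; rewrite patchE memNset//= in_itv.
case: p p1 fN {fL} => [p| |//]; last first.
  (* The norm of index [+oo] is the essential supremum only on a space of positive measure. *)
  move=> _; rewrite unlock /= ifT; last first.
    apply: (@lt_le_trans _ _ (mu `[0, T]%classic)).
      by rewrite lebesgue_measure_itv/= lte_fin T0 sube0 lte_fin.
    by apply: le_measure; rewrite ?inE.
  set M := ess_sup_inf.ess_sup _ _ => My.
  have := ess_sup_inf.ess_sup_ge mu (abse \o (EFin \o f \_ `[0, T])).
  rewrite -/M => HM.
  exists (\1_(`[0, T])), (Num.max 0 (fine M)); split.
  - exact: measurable_indic.
  - by move=> x; rewrite indicE; case: (_ \in _); [right|left].
  - by rewrite integral_indic//= setIT lebesgue_measure_itv/= lte_fin T0 ltry.
  - by rewrite le_max lexx.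
  - move: HM; apply: filterS => x /= HMx.
    have [xT|xT] := pselect (0 <= x <= T); last first.
      by rewrite f0// normr0 mulr_ge0 ?gpow_ge0// le_max lexx.
    rewrite indic_itvcc1//.
    rewrite /gpow oner_eq0 powR1 mulr1 le_max.
    move: HMx My; case: M => [M| |]//=; rewrite lee_fin => -> _.
    by rewrite orbT.
rewrite lee_fin => p1 fN.
have p0 : 0 < p by exact: lt_le_trans p1.
pose g := f \_ `[0, T].
(* The added [1] keeps [N] positive when [f] vanishes almost everywhere. *)
pose N := fine ('N[mu]_p%:E[EFin \o g])%E + 1.
have N0 : 0 < N by rewrite ltr_wpDl// fine_ge0 ?Lnorm_ge0.
have [] := @gpow_dominant_fin T p N _ T0 p1 N0 mf' f0.
  have p00 : p != 0 by rewrite gt_eqF.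
  have <- := @poweR_Lnorm _ _ _ mu (EFin \o g) p p00.
  rewrite -[X in (X `^ _ <= _)%E]fineK ?ge0_fin_numE ?Lnorm_ge0//.
  rewrite poweR_EFin lee_fin ge0_ler_powR ?nnegrE ?fine_ge0 ?Lnorm_ge0 ?ltW//.
  by rewrite /N ltrDl.
move=> B [mB hB IB fB]; exists B, N; split => //.
- by rewrite (le_lt_trans IB)// ltry.
- exact: ltW.
- by apply: nearW => x; rewrite inver gt_eqF.
Qed.

End Lebesgue_dominants.

(** * The Volterra kernel *)

Lemma inve_ge_fin {R : realType} (k : R) (p : \bar R) : 0 < k -> (k%:E <= p)%E ->
  (p^-1 = (fine p^-1)%:E)%E /\ 0 <= fine p^-1 <= k^-1.
Proof.
move=> k0; case: p => [p| |//]; last first.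
  by move=> _; rewrite invey /= lexx invr_ge0 ltW.
rewrite lee_fin => kp; have p0 : 0 < p by exact: lt_le_trans kp.
by rewrite inver gt_eqF//= invr_ge0 ltW//= lef_pV2.
Qed.

Lemma ae_imply {d} {T : ringOfSetsType d} {R : realFieldType}
    (mu : {measure set T -> \bar R}) (P Q : T -> Prop) :
  {ae mu, forall x, P x} -> (forall x, P x -> Q x) -> {ae mu, forall x, Q x}.
Proof. by move=> aeP PQ; apply: filterS aeP. Qed.

Section kernel_L2_bound.
Context {R : realType}.
Local Notation mu := (@lebesgue_measure R).

(** An extended real on purpose: it is estimated first, and its finiteness almost everywhere then
    gives the integrability of the signed integrand. *)
Definition abs_conv (f c : R -> R) (s : R) : \bar R :=
  (\int[mu]_u (`|f u| * `|c (u - s)|)%:E)%E.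

Lemma measurable_conv_integrand (f c : R -> R) : measurable_fun setT f ->
  measurable_fun setT c ->
  measurable_fun setT (fun z : measurableTypeR R * measurableTypeR R =>
    f z.2 * c (z.2 - z.1)).
Proof.
move=> mf mc; apply: measurable_funM.
  exact: (measurableT_comp mf measurable_snd).
apply: (measurableT_comp mc); apply: measurable_funB.
  exact: measurable_snd.
exact: measurable_fst.
Qed.

Lemma measurable_abs_conv (f c : R -> R) : measurable_fun setT f ->
  measurable_fun setT c -> measurable_fun [set: R] (abs_conv f c).
Proof.
move=> mf mc.
have mf' : measurable_fun setT (fun x => `|f x|) by exact: measurableT_comp.
have mc' : measurable_fun setT (fun x => `|c x|) by exact: measurableT_comp.
have mfc : measurable_fun setT (fun z : measurableTypeR R * measurableTypeR R =>
    (`|f z.2| * `|c (z.2 - z.1)|)%:E).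
  by apply/measurable_EFinP; exact: (measurable_conv_integrand mf' mc').
apply: (measurable_fun_fubini_tonelli_F (m2 := mu) _ mfc) => z.
by rewrite lee_fin mulr_ge0.
Qed.

Lemma abs_conv_ge0 (f c : R -> R) s : (0 <= abs_conv f c s)%E.
Proof. by apply: integral_ge0 => u _; rewrite lee_fin mulr_ge0. Qed.

Lemma abs_conv_le_gpow (f c B C : R -> R) (N M b g : R) (s : R) :
  measurable_fun setT f -> measurable_fun setT c ->
  measurable_fun setT B -> measurable_fun setT C -> 0 <= N -> 0 <= M ->
  (forall x, `|f x| <= N * gpow (B x) b) ->
  {ae mu, forall x, `|c x| <= M * gpow (C x) g} ->
  (abs_conv f c s <= (N * M)%:E * gpow_conv B C b g s)%E.
Proof.
move=> mf mc mB mC N0 M0 fB cC.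
have mG : measurable_fun [set: R] (fun u : R => (gpow (B u) b * gpow (C (u - s)) g)%:E).
  apply/measurable_EFinP; apply: measurable_funM.
    exact: (measurableT_comp (measurable_gpow b) mB).
  apply: (measurableT_comp (measurable_gpow g)).
  exact: (measurableT_comp mC (measurable_translate (- s))).
rewrite /gpow_conv -(ge0_integralZl mu measurableT mG); last 2 first.
- by move=> u _; rewrite lee_fin mulr_ge0 ?gpow_ge0.
- by rewrite lee_fin mulr_ge0.
apply: ae_ge0_le_integral; first exact: measurableT.
- by move=> u _; rewrite lee_fin mulr_ge0.
- apply/measurable_EFinP; apply: measurable_funM.
    exact: measurableT_comp.
  apply: measurableT_comp => //.
  exact: (measurableT_comp mc (measurable_translate (- s))).
- by move=> u _; rewrite mule_ge0// lee_fin mulr_ge0 ?gpow_ge0.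
- by apply: measurable_funeM.
apply: (ae_imply (ae_shift (- s) cC)) => u Hu _.
by rewrite lee_fin mulrACA; apply: ler_pM.
Qed.

(** [K] is chosen before [f], which is possible because the weight of [f] has integral at most
    [T + 1]. This uniformity allows the bound to be applied to [b] cut down to any subinterval. *)
Lemma kernel_L2_bound (T : R) (a c : R -> R) (p : \bar R) (q : R) (r : \bar R) :
  0 < T -> (2%:E <= p)%E -> 1 <= q -> (1 <= r)%E ->
  (p^-1 + (q%:E)^-1 + r^-1 <= (3 / 2)%:E)%E ->
  Lp_on T p a -> Lp_on T r c ->
  exists2 K : R, 0 <= K & forall (f : R -> R) (N : R),
    0 < N -> measurable_fun setT f -> (forall x, ~ 0 <= x <= T -> f x = 0) ->
    (\int[mu]_x (`|f x| `^ q)%:E <= (N `^ q)%:E)%E ->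
    (\int[mu]_s ((((a \_ `[0%R, T]) s) ^+ 2)%:E *
      (abs_conv f (c \_ `[0%R, T]) s * abs_conv f (c \_ `[0%R, T]) s)) <=
    (K * N ^+ 2)%:E)%E.
Proof.
move=> T0 p2 q1 r1 pqr aL cL.
have p1 : (1 <= p)%E by apply: le_trans p2; rewrite lee_fin ler1n.
have q0 : 0 < q by exact: lt_le_trans q1.
have [pE /andP[al0 al1]] := inve_ge_fin (ltr0n _ 2) p2.
have [rE /andP[ga0 ga1]] := inve_ge_fin ltr01 r1.
move: pqr; rewrite pE rE inver gt_eqF// -!EFinD lee_fin => pqr.
set al := fine p^-1 in al0 al1 pqr; set ga := fine r^-1 in ga0 ga1 pqr.
have [A [Na [mA hA IA Na0 aA]]] := gpow_dominant T0 p1 aL.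
have [C [Nc [mC hC IC Nc0 cC]]] := gpow_dominant T0 r1 cL.
have mc : measurable_fun setT (c \_ `[0, T]).
  by have := sub_Lfun_mfun cL; rewrite inE.
have ma : measurable_fun setT (a \_ `[0, T]).
  by have := sub_Lfun_mfun aL; rewrite inE.
set ct := c \_ `[0, T] in mc cC *; set at_ := a \_ `[0, T] in ma aA *.
pose IA' := fine (\int[mu]_x (A x)%:E)%E.
pose IC' := fine (\int[mu]_x (C x)%:E)%E.
have IA_ge0 : (0 <= \int[mu]_x (A x)%:E)%E by exact: integral_weight_ge0.
have IC_ge0 : (0 <= \int[mu]_x (C x)%:E)%E by exact: integral_weight_ge0.
have IAE : (\int[mu]_x (A x)%:E = IA'%:E)%E by rewrite fineK// ge0_fin_numE.
have ICE : (\int[mu]_x (C x)%:E = IC'%:E)%E by rewrite fineK// ge0_fin_numE.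
have IA'0 : 0 <= IA' by exact: fine_ge0.
have IC'0 : 0 <= IC' by exact: fine_ge0.
(* The right-hand side of [trilinear_bound] with the integral of the weight of [f] replaced by
   [T + 1]. *)
pose L := ((T + 1) * (IA' + IC') + IC' * (IA' + (T + 1))) * ((T + 1) + IC').
have T0' : 0 <= T by exact: ltW.
have T10 : 0 <= T + 1 by rewrite addr_ge0.
have L0 : 0 <= L by rewrite /L !(mulr_ge0, addr_ge0).
exists (Na ^+ 2 * Nc ^+ 2 * L); first by apply: mulr_ge0 => //; apply: mulr_ge0; exact: sqr_ge0.
move=> f N N0 mf f0 fN.
have [B [mB hB IB fB]] := gpow_dominant_fin T0 q1 N0 mf f0 fN.
have be01 : 0 <= q^-1 <= 1 by rewrite invr_ge0 ltW//= invf_le1.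
have tri := @trilinear_bound R A B C mA mB mC hA hB hC al q^-1 ga _ be01 _ pqr.
have {}tri : (\int[mu]_s ((gpow (A s) (al *+ 2))%:E *
    (gpow_conv B C q^-1 ga s * gpow_conv B C q^-1 ga s)) <= L%:E)%E.
  apply: (le_trans (tri _ _)); [by rewrite al0 div1r|by rewrite ga0 -[1]invr1|].
  have [IB' IBE] : exists IB' : R, (\int[mu]_x (B x)%:E = IB'%:E)%E.
    have IBf : (\int[mu]_x (B x)%:E \is a fin_num)%E.
      rewrite ge0_fin_numE; first exact: le_lt_trans IB (ltry _).
      exact: integral_weight_ge0.
    by exists (fine (\int[mu]_x (B x)%:E)%E); rewrite fineK.
  have IB'0 : 0 <= IB'.
    by rewrite -lee_fin -IBE; exact: integral_weight_ge0.
  have IB'1 : IB' <= T + 1 by move: IB; rewrite IBE lee_fin.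
  rewrite IBE IAE ICE -!EFinD -!EFinM lee_fin /L.
  by rewrite !(ler_pM, lerD, mulr_ge0, addr_ge0).
have mgA : measurable_fun [set: R] (fun s => (gpow (A s) (al *+ 2))%:E).
  by apply/measurable_EFinP; exact: (measurableT_comp (measurable_gpow _) mA).
have mG := measurable_gpow_conv mB mC q^-1 ga.
have mH : measurable_fun [set: R] (fun s => ((gpow (A s) (al *+ 2))%:E *
    (gpow_conv B C q^-1 ga s * gpow_conv B C q^-1 ga s))%E).
  by apply: emeasurable_funM => //; exact: emeasurable_funM.
have sq0 : 0 <= Na ^+ 2 * Nc ^+ 2 * N ^+ 2.
  by apply: mulr_ge0; [apply: mulr_ge0|]; exact: sqr_ge0.
apply: (@le_trans _ _ ((Na ^+ 2 * Nc ^+ 2 * N ^+ 2)%:E * L%:E)%E); last first.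
  by rewrite -EFinM lee_fin mulrAC.
apply: le_trans (lee_wpmul2l _ tri); last by rewrite lee_fin.
rewrite -(ge0_integralZl mu measurableT mH); last 2 first.
- by move=> s _; rewrite !mule_ge0 ?gpow_conv_ge0// lee_fin gpow_ge0.
- by rewrite lee_fin.
have mJ := measurable_abs_conv mf mc.
apply: ae_ge0_le_integral; first exact: measurableT.
- by move=> s _; rewrite !mule_ge0 ?abs_conv_ge0// lee_fin sqr_ge0.
- apply: emeasurable_funM; last exact: emeasurable_funM.
  by apply/measurable_EFinP; exact: measurable_funX.
- by move=> s _; rewrite !mule_ge0 ?gpow_conv_ge0// lee_fin ?gpow_ge0.
- exact: measurable_funeM.
apply: (ae_imply aA) => s Hs _.
have HJ := abs_conv_le_gpow s mf mc mB mC (ltW N0) Nc0 fB cC.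
apply: (@le_trans _ _ ((Na ^+ 2 * gpow (A s) (al *+ 2))%:E *
    (((N * Nc)%:E * gpow_conv B C q^-1 ga s) *
     ((N * Nc)%:E * gpow_conv B C q^-1 ga s)))%E).
  apply: lee_pmul.
  - by rewrite lee_fin sqr_ge0.
  - by rewrite mule_ge0 ?abs_conv_ge0.
  - rewrite lee_fin -real_normK ?num_real// mulr2n gpowD -expr2 -exprMn.
    by rewrite lerXn2r ?nnegrE ?mulr_ge0 ?gpow_ge0.
  - by apply: lee_pmul; rewrite ?abs_conv_ge0.
rewrite le_eqVlt; apply/orP; left; apply/eqP.
rewrite [X in (_ * X)%E]muleACA [LHS]muleA [RHS]muleA -!EFinM.
by congr (_%:E * _)%E; ring.
Qed.

End kernel_L2_bound.

(** * Truncation, integrability and increments of the kernel *)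

Section volterra_kernel.
Context {R : realType}.
Local Notation mu := (@lebesgue_measure R).

Definition conv (f c : R -> R) (s : R) : R :=
  Rintegral mu setT (fun u => f u * c (u - s)).

Lemma measurable_conv (f c : R -> R) : measurable_fun setT f ->
  measurable_fun setT c -> measurable_fun [set: R] (conv f c).
Proof.
move=> mf mc; rewrite /conv /Rintegral.
apply: (measurableT_comp (fine_measurable measurableT)).
pose g (z : measurableTypeR R * measurableTypeR R) := (f z.2 * c (z.2 - z.1))%:E.
have mg : measurable_fun setT g.
  by apply/measurable_EFinP; exact: measurable_conv_integrand.
have mp := measurable_fun_fubini_tonelli_F (m2 := mu) _
  (measurable_funepos mg) (@funepos_ge0 _ _ g).
have mn := measurable_fun_fubini_tonelli_F (m2 := mu) _
  (measurable_funeneg mg) (@funeneg_ge0 _ _ g).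
have -> : (fun s : R => \int[mu]_u (f u * c (u - s))%:E)%E =
    (fun s => fubini_F mu (g^\+)%E s - fubini_F mu (g^\-)%E s)%E.
  apply/funext => s; rewrite [LHS]integralE.
  by congr (_ - _)%E; apply: eq_integral => u _; rewrite ?funeposE ?funenegE.
exact: emeasurable_funB.
Qed.

Lemma measurable_conv_section (f c : R -> R) (s : R) : measurable_fun setT f ->
  measurable_fun setT c -> measurable_fun [set: R] (fun u => f u * c (u - s)).
Proof.
move=> mf mc; apply: measurable_funM => //.
exact: (measurableT_comp mc (measurable_translate (- s))).
Qed.

Lemma normr_conv_le (f c : R -> R) (s : R) : measurable_fun setT f ->
  measurable_fun setT c -> ((`|conv f c s|)%:E <= abs_conv f c s)%E.
Proof.
move=> mf mc.
have m : measurable_fun [set: R] (fun u => (f u * c (u - s))%:E).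
  by apply/measurable_EFinP; exact: measurable_conv_section.
have -> : abs_conv f c s = (\int[mu]_u `|(f u * c (u - s))%:E|)%E.
  by apply: eq_integral => u _ /=; rewrite normrM.
apply: le_trans (le_abse_integral mu measurableT m).
rewrite /conv /Rintegral.
(* An infinite integral is read as [0] by [fine], which keeps the bound true. *)
by case: (\int[mu]_u _)%E => [r| |] //=; rewrite normr0 leey.
Qed.

Lemma conv_integrable (f c : R -> R) (s : R) : measurable_fun setT f ->
  measurable_fun setT c -> (abs_conv f c s < +oo)%E ->
  mu.-integrable setT (fun u => (f u * c (u - s))%:E).
Proof.
move=> mf mc Hs; apply/integrableP; split.
  by apply/measurable_EFinP; exact: measurable_conv_section.
by under eq_integral do rewrite /= normrM.
Qed.

Lemma le_abs_conv (f g c : R -> R) (s : R) : measurable_fun setT f ->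
  measurable_fun setT g -> measurable_fun setT c ->
  (forall u, `|f u| <= `|g u|) -> (abs_conv f c s <= abs_conv g c s)%E.
Proof.
move=> mf mg mc fg.
have mn (h : R -> R) : measurable_fun setT h ->
    measurable_fun setT (fun u => `|h u|) by move=> ?; exact: measurableT_comp.
apply: ge0_le_integral; first exact: measurableT.
- by move=> u _; rewrite lee_fin mulr_ge0.
- by apply/measurable_EFinP; exact: (measurable_conv_section s (mn _ mf) (mn _ mc)).
- by apply/measurable_EFinP; exact: (measurable_conv_section s (mn _ mg) (mn _ mc)).
- by move=> u _; rewrite lee_fin ler_wpM2r.
Qed.

(** Cutting [c] to [[0, T]] forces [v <= u], and cutting [b] to [[0, t]] forces [u <= t]. The limits
    of integration are absorbed, and [t] survives only in the truncation of [b]. *)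
Lemma inner_integrand_restrict (b c : R -> R) (T t v : R) :
  0 <= v -> t <= T ->
  inner_integrand b c v \_ `[v, t] =
  (fun u => (b \_ `[0, t]) u * (c \_ `[0, T]) (u - v)).
Proof.
move=> v0 tT; apply/funext => u; rewrite !patchE.
have [uv|uv] := pselect (v <= u <= t).
  have /andP[vu ut] := uv.
  rewrite !mem_set//= in_itv//=; first by rewrite subr_ge0 vu /=; lra.
  by rewrite ut andbT; lra.
rewrite memNset/=; last by rewrite in_itv.
case: ifPn => [|_]; last by rewrite mul0r.
rewrite inE/= in_itv/= => /andP[u0 ut].
rewrite memNset ?mulr0//= in_itv/= => /andP[uv0 _]; apply: uv.
by rewrite -subr_ge0 uv0.
Qed.

Lemma volterra_kernel_restrict (a b c : R -> R) (T t : R) : 0 <= t <= T ->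
  volterra_kernel a b c t \_ `[0, t] =
  (fun v => (a \_ `[0, T]) v * conv (b \_ `[0, t]) (c \_ `[0, T]) v).
Proof.
move=> /andP[t0 tT]; apply/funext => v; rewrite patchE.
have [vt|vt] := pselect (0 <= v <= t).
  have /andP[v0 vt'] := vt.
  rewrite mem_set/=; last by rewrite in_itv.
  rewrite patchE mem_set/=; last by rewrite in_itv/= v0 (le_trans vt').
  by rewrite /volterra_kernel Rintegral_mkcond (inner_integrand_restrict _ _ v0 tT).
rewrite memNset/=; last by rewrite in_itv.
have [v0|v0] := ltP v 0.
  by rewrite patchE memNset ?mul0r//= in_itv/= leNgt v0.
(* Beyond [t] the right-hand side vanishes too: [u <= t < v] makes [u - v] negative, where the
   truncated [c] is [0]. *)
have tv : t < v by rewrite ltNge; apply/negP => vt'; apply: vt; rewrite v0.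
rewrite /conv (_ : (fun _ => _) = cst 0); first by rewrite Rintegral_cst//= ?mul0r ?mulr0.
apply/funext => u /=.
have /= <- := congr1 (@^~ u) (inner_integrand_restrict b c v0 tT); rewrite patchE.
by rewrite set_itv_ge ?in_set0// bnd_simp -ltNge.
Qed.

Section bounds.
Variables (T : R) (a b c : R -> R) (p : \bar R) (q : R) (r : \bar R).
Hypotheses (T0 : 0 < T) (p2 : (2%:E <= p)%E) (q1 : 1 <= q) (r1 : (1 <= r)%E)
  (pqr : (p^-1 + (q%:E)^-1 + r^-1 <= (3 / 2)%:E)%E)
  (aL : Lp_on T p a) (bL : Lp_on T q%:E b) (cL : Lp_on T r c).

Let cT := c \_ `[0, T].
Let aT := a \_ `[0, T].

Lemma Lp_on_measurable p' (f : R -> R) :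
  Lp_on T p' f -> measurable_fun setT (f \_ `[0, T]).
Proof. by move=> fL; have := sub_Lfun_mfun fL; rewrite inE. Qed.

Lemma measurable_subrestrict p' (f : R -> R) (A : set R) : Lp_on T p' f ->
  measurable A -> A `<=` `[0, T] -> measurable_fun setT (f \_ A).
Proof.
move=> fL mA AT; apply: (proj1 (measurable_restrictT f mA)).
apply: (measurable_funS (measurable_itv `[0, T]) AT).
exact: (proj2 (measurable_restrictT f (measurable_itv _)) (Lp_on_measurable fL)).
Qed.

Let mcT : measurable_fun setT cT. Proof. exact: Lp_on_measurable cL. Qed.
Let maT : measurable_fun setT aT. Proof. exact: Lp_on_measurable aL. Qed.

Lemma restrict_itv_eq0 (f : R -> R) (A : set R) (x : R) :
  A `<=` `[0, T] -> ~ 0 <= x <= T -> (f \_ A) x = 0.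
Proof.
move=> AT xT; rewrite patchE memNset// => /AT /=.
by rewrite in_itv.
Qed.

Lemma Lp_on_power_integral_lty :
  (\int[mu]_x (`|(b \_ `[0%R, T]) x| `^ q)%:E < +oo)%E.
Proof.
have := sub_Lfun_finLfun bL; rewrite inE /= /finite_norm.
have q0 : q != 0 by rewrite gt_eqF// (lt_le_trans _ q1).
move=> Hb; have /= <- := @poweR_Lnorm _ _ _ mu (EFin \o (b \_ `[0, T])) q q0.
exact: poweR_lty.
Qed.

Lemma restrict_power_integral_lt (A : set R) : measurable A -> A `<=` `[0, T] ->
  exists2 N : R, 0 < N & (\int[mu]_x (`|(b \_ A) x| `^ q)%:E <= (N `^ q)%:E)%E.
Proof.
move=> mA AT.
have q0 : 0 < q by exact: lt_le_trans q1.
have mb : measurable_fun setT (b \_ A) by exact: measurable_subrestrict bL mA AT.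
have mb' : measurable_fun setT (b \_ `[0, T]) by exact: Lp_on_measurable bL.
have mpow (f : R -> R) : measurable_fun setT f ->
    measurable_fun [set: R] (fun x => (`|f x| `^ q)%:E).
  move=> mf; apply/measurable_EFinP; apply: (measurableT_comp (measurable_powR q)).
  exact: measurableT_comp.
have bT := Lp_on_power_integral_lty.
set I := (\int[mu]_x (`|(b \_ `[0%R, T]) x| `^ q)%:E)%E in bT.
have I0 : (0 <= I)%E by apply: integral_ge0 => x _; rewrite lee_fin powR_ge0.
pose M := fine I + 1.
have M0 : 0 < M by rewrite ltr_wpDl// fine_ge0.
exists (M `^ q^-1); first exact: powR_gt0.
rewrite -powRrM mulVf ?gt_eqF// powRr1; last exact: ltW.
apply: (@le_trans _ _ I); last first.
  by rewrite -[I]fineK ?ge0_fin_numE// lee_fin /M lerDl.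
apply: ge0_le_integral; first exact: measurableT.
- by move=> x _; rewrite lee_fin powR_ge0.
- exact: mpow.
- exact: mpow.
move=> x _; rewrite lee_fin ge0_ler_powR ?nnegrE//; first exact: ltW.
rewrite !patchE; case: ifPn => [|_]; last by rewrite normr0.
by rewrite inE => /AT xT; rewrite mem_set.
Qed.

Lemma sub_itvcc t : t <= T -> `[0, t] `<=` `[0, T].
Proof. by move=> tT x /=; rewrite !in_itv/= => /andP[-> xt]; exact: le_trans tT. Qed.

Lemma sub_itvoc s t : 0 <= s -> t <= T -> `]s, t] `<=` `[0, T].
Proof.
move=> s0 tT x /=; rewrite !in_itv/= => /andP[sx xt].
by rewrite (le_trans s0 (ltW sx)) (le_trans xt).
Qed.

(** [kernel_L2_bound] is applied with the constant [1] of index [+oo] in place of [a]: since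
    [0 * +oo = 0], the zeros of [a] would hide infinite values of the convolution. The condition on
    the exponents persists because 1/oo = 0 <= 1/p. *)
Lemma abs_conv_ae_lty (t : R) : 0 <= t <= T ->
  {ae mu, forall s, 0 <= s <= T -> (abs_conv (b \_ `[0%R, t]) cT s < +oo)%E}.
Proof.
move=> /andP[t0 tT].
have one : Lp_on T +oo%E (cst 1 : R -> R).
  rewrite /Lp_on inE; apply/andP; split; rewrite inE/=.
    by apply: (proj1 (measurable_restrictT _ (measurable_itv _))); exact: measurable_cst.
  rewrite /finite_norm unlock; case: ifPn => // _.
  apply: (@le_lt_trans _ _ 1%E); last exact: ltry.
  apply/ess_sup_inf.ess_supP; apply: nearW => x /=.
  by rewrite lee_fin patchE; case: ifPn => _; rewrite ?normr1 ?normr0.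
have pqr' : ((+oo)^-1 + (q%:E)^-1 + r^-1 <= (3 / 2)%:E)%E.
  apply: le_trans pqr; rewrite invey add0e; apply: leeD => //.
  by rewrite leeDr// inve_ge0 (le_trans _ p2).
have [K K0 HK] := kernel_L2_bound T0 (leey _) q1 r1 pqr' one cL.
have mb : measurable_fun setT (b \_ `[0, t]).
  by apply: measurable_subrestrict bL _ _ => //; exact: sub_itvcc.
have [N N0 HN] := restrict_power_integral_lt (measurable_itv _) (sub_itvcc tT).
have {}HK := HK _ N N0 mb (fun x => restrict_itv_eq0 b (sub_itvcc tT)) HN.
have m1 : measurable_fun setT ((cst 1 : R -> R) \_ `[0, T]).
  exact: Lp_on_measurable one.
have mJ := measurable_abs_conv mb mcT.
set F := (fun s => _ * (_ * _))%E in HK.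
have F0 s : (0 <= F s)%E.
  by rewrite /F !mule_ge0 ?abs_conv_ge0// lee_fin sqr_ge0.
have mF : measurable_fun [set: R] F.
  apply: emeasurable_funM; last exact: emeasurable_funM.
  by apply/measurable_EFinP; exact: measurable_funX.
have iF : mu.-integrable setT F.
  apply/integrableP; split => //.
  rewrite (eq_integral F); first exact: le_lt_trans HK (ltry _).
  by move=> s _; rewrite gee0_abs.
apply: (ae_imply (integrable_ae measurableT iF)) => s /(_ I) + sT.
rewrite /F patchE mem_set/=; last by rewrite in_itv.
rewrite expr1n mul1e; have := abs_conv_ge0 (b \_ `[0, t]) cT s.
by case: (abs_conv _ _ _) => [x| |] // _; rewrite ?ltry.
Qed.

Lemma volterra_kernel_well_defined (t : R) : 0 <= t <= T ->
  kernel_well_defined a b c t.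
Proof.
move=> tT'; have /andP[t0 tT] := tT'.
have mb : measurable_fun setT (b \_ `[0, t]).
  by apply: measurable_subrestrict bL _ _ => //; exact: sub_itvcc.
split.
  apply: (ae_imply (abs_conv_ae_lty tT')) => s Hs /andP[s0 st].
  apply/integrable_mkcond => //.
  rewrite restrict_EFin (inner_integrand_restrict _ _ s0 tT).
  by apply: conv_integrable => //; apply: Hs; rewrite s0 (le_trans st).
have [K K0 HK] := kernel_L2_bound T0 p2 q1 r1 pqr aL cL.
have [N N0 HN] := restrict_power_integral_lt (measurable_itv _) (sub_itvcc tT).
have {}HK := HK _ N N0 mb (fun x => restrict_itv_eq0 b (sub_itvcc tT)) HN.
rewrite /Lp_on (volterra_kernel_restrict _ _ _ tT').
have mk : measurable_fun setT (fun v => aT v * conv (b \_ `[0, t]) cT v).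
  by apply: measurable_funM => //; exact: measurable_conv.
rewrite inE; apply/andP; split; rewrite inE//= /finite_norm.
rewrite ltNge; apply/negP; rewrite leye_eq => /eqP Ny.
have := sqr_Lnorm2 mu (fun v => aT v * conv (b \_ `[0, t]) cT v).
rewrite Ny mulyy => /esym Hy; move: HK; apply/negP; rewrite -ltNge.
apply: (@lt_le_trans _ _ +oo%E); first exact: ltry.
rewrite -Hy; apply: ge0_le_integral; first exact: measurableT.
- by move=> v _; rewrite lee_fin sqr_ge0.
- by apply/measurable_EFinP; exact: measurable_funX.
- apply: emeasurable_funM.
    by apply/measurable_EFinP; exact: measurable_funX.
  by apply: emeasurable_funM; exact: measurable_abs_conv.
move=> v _; rewrite exprMn EFinM; apply: lee_wpmul2l; first by rewrite lee_fin sqr_ge0.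
rewrite -real_normK ?num_real// expr2 EFinM.
by apply: lee_pmul => //; rewrite ?lee_fin// normr_conv_le.
Qed.

(** The convolution is additive in the truncation of [b], and [[0, t]] is the disjoint union of
    [[0, s]] and []s, t]], so the increment in [t] is the kernel built from [b] on []s, t]]. The
    additivity of the inner integral holds for almost every [v] in [[0, T]] by [abs_conv_ae_lty]. *)
Lemma volterra_kernel_increment : exists2 K : R, 0 <= K & forall s t N : R,
  0 <= s -> s <= t -> t <= T -> 0 < N ->
  (\int[mu]_x (`|(b \_ `]s, t]) x| `^ q)%:E <= (N `^ q)%:E)%E ->
  (\int[mu]_v (((volterra_kernel a b c t \_ `[0%R, t]) v -
    (volterra_kernel a b c s \_ `[0%R, s]) v) ^+ 2)%:E <= (K * N ^+ 2)%:E)%E.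
Proof.
have [K K0 HK] := kernel_L2_bound T0 p2 q1 r1 pqr aL cL.
exists K => // s t N s0 st tT N0 HN.
have t0 : 0 <= t by exact: le_trans st.
have sT : s <= T by exact: le_trans tT.
have tT' : 0 <= t <= T by rewrite t0.
have sT' : 0 <= s <= T by rewrite s0.
have mbst : measurable_fun setT (b \_ `]s, t]).
  by apply: measurable_subrestrict bL _ _ => //; exact: sub_itvoc.
have mb u : u <= T -> measurable_fun setT (b \_ `[0, u]).
  by move=> uT; apply: measurable_subrestrict bL _ _ => //; exact: sub_itvcc.
apply: le_trans (HK _ N N0 mbst (fun x => restrict_itv_eq0 b (sub_itvoc s0 tT)) HN).
rewrite (volterra_kernel_restrict _ _ _ tT') (volterra_kernel_restrict _ _ _ sT').
apply: ae_ge0_le_integral; first exact: measurableT.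
- by move=> v _; rewrite lee_fin sqr_ge0.
- apply/measurable_EFinP; apply: measurable_funX; apply: measurable_funB;
    by apply: measurable_funM => //; apply: measurable_conv => //; exact: mb.
- by move=> v _; rewrite !mule_ge0 ?abs_conv_ge0// lee_fin sqr_ge0.
- apply: emeasurable_funM.
    by apply/measurable_EFinP; exact: measurable_funX.
  by apply: emeasurable_funM; exact: measurable_abs_conv.
apply: (ae_imply (abs_conv_ae_lty tT')) => v Hv _.
rewrite -/aT -/cT.
have [v0T|v0T] := pselect (0 <= v <= T); last first.
  by rewrite /aT restrict_itv_eq0// !mul0r subrr expr0n/= mul0e.
have {}Hv := Hv v0T.
have split_b u : (b \_ `[0, t]) u = (b \_ `[0, s]) u + (b \_ `]s, t]) u.
  rewrite !patchE; have [us|us] := leP u s.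
    rewrite [X in _ + X](_ : _ = 0) ?addr0; last first.
      by rewrite memNset//= in_itv/= ltNge us.
    by rewrite !mem_setE !in_itv/= us (le_trans us st).
  rewrite [X in X + _](_ : _ = 0) ?add0r; last first.
    by rewrite memNset//= in_itv/= [u <= s]leNgt us andbF.
  by rewrite !mem_setE !in_itv/= us (le_trans s0 (ltW us)).
have le_s u : `|(b \_ `[0, s]) u| <= `|(b \_ `[0, t]) u|.
  rewrite !patchE; case: ifPn => [|_]; last by rewrite normr0.
  rewrite inE/= in_itv/= => /andP[u0 us]; rewrite mem_set//= in_itv/= u0.
  exact: le_trans st.
have le_st u : `|(b \_ `]s, t]) u| <= `|(b \_ `[0, t]) u|.
  rewrite !patchE; case: ifPn => [|_]; last by rewrite normr0.
  rewrite inE/= in_itv/= => /andP[u0 us]; rewrite mem_set//= in_itv/= us andbT.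
  by rewrite (le_trans s0)// ltW.
have is_ : mu.-integrable setT (fun u => ((b \_ `[0, s]) u * cT (u - v))%:E).
  apply: conv_integrable => //; first exact: mb.
  by apply: le_lt_trans Hv; apply: le_abs_conv => //; exact: mb.
have ist : mu.-integrable setT (fun u => ((b \_ `]s, t]) u * cT (u - v))%:E).
  apply: conv_integrable => //.
  by apply: le_lt_trans Hv; apply: le_abs_conv => //; exact: mb.
have -> : conv (b \_ `[0, t]) cT v =
    conv (b \_ `[0, s]) cT v + conv (b \_ `]s, t]) cT v.
  rewrite /conv -RintegralD//; congr (Rintegral mu setT _).
  by apply/funext => u; rewrite split_b mulrDl.
rewrite mulrDr addrAC subrr add0r exprMn EFinM.
apply: lee_wpmul2l; first by rewrite lee_fin sqr_ge0.
rewrite -real_normK ?num_real// expr2 EFinM.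
by apply: lee_pmul => //; rewrite ?lee_fin// normr_conv_le.
Qed.

End bounds.
End volterra_kernel.

(** * Independence and moment generating functions *)

Section density_transfer.
Context d d' (Omega : measurableType d) (U : measurableType d') {R : realType}.
Local Notation mu := (@lebesgue_measure R).
Local Open Scope ereal_scope.

Lemma integral_indic_itvco (x : R) : (0 <= x)%R ->
  \int[mu]_t (\1_(`[0%R, x[%classic) t)%:E = x%:E.
Proof.
move=> x0; rewrite integral_indic//= setIT lebesgue_measure_itv/= lte_fin.
by case: ltP => x0'; rewrite ?sube0//; congr EFin; apply/le_anti/andP.
Qed.

Let sublevel (f : U -> R) (t : R) : set U := [set y | 0 <= t < f y]%R.

Let sublevelE (f : U -> R) (t : R) (y : U) :
  \1_(sublevel f t) y = \1_(`[0%R, f y[%classic) t :> R.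
Proof. by rewrite !indicE; congr (_%:R); apply/idP/idP; rewrite !inE/= in_itv. Qed.

Lemma measurable_sublevel (f : U -> R) (t : R) :
  measurable_fun setT f -> measurable (sublevel f t).
Proof.
move=> mf; case: (leP 0%R t) => t0.
  rewrite (_ : sublevel f t = f @^-1` `]t, +oo[%classic).
    by rewrite -[X in measurable X]setTI; exact: mf.
  by apply/seteqP; split => y /=; rewrite /sublevel/= t0 in_itv/= andbT.
rewrite (_ : sublevel f t = set0)//.
by apply/seteqP; split => // y; rewrite /sublevel/= leNgt t0.
Qed.

Let measurable_hypograph d1 (T : measurableType d1) (f : T -> R) :
  measurable_fun setT f ->
  measurable_fun setT (fun z : T * measurableTypeR R =>
    (\1_(`[0%R, f z.1[%classic) z.2 : R)).
Proof.
move=> mf; rewrite (_ : (fun z => _) =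
    \1_[set z : T * measurableTypeR R | (0 <= z.2 < f z.1)%R]).
  apply: measurable_indic.
  rewrite (_ : [set _ | _] = (snd @^-1` `[0%R, +oo[%classic) `&`
    ((fun z : T * measurableTypeR R => f z.1 - z.2)%R @^-1` `]0%R, +oo[%classic)).
    apply: measurableI; rewrite -[X in measurable X]setTI.
      exact: measurable_snd.
    have m : measurable_fun setT (fun z : T * measurableTypeR R => f z.1 - z.2)%R.
      apply: measurable_funB; last exact: measurable_snd.
      exact: (measurableT_comp mf measurable_fst).
    exact: m.
  apply/seteqP; split => z /=; rewrite !in_itv/= !andbT subr_gt0.
    by move=> /andP[].
  by move=> [-> ->].
by apply/funext => z; rewrite !indicE; congr (_%:R);
  apply/idP/idP; rewrite !inE/= in_itv.
Qed.

(* Tonelli for the layer-cake formula [f y = \int_t 1_(t < f y)]. *)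
Lemma integral_density_transfer (m : {sigma_finite_measure set Omega -> \bar R})
    (nu : {sigma_finite_measure set U -> \bar R})
    (Y : Omega -> U) (G : Omega -> R) (c : \bar R) (f : U -> R) :
  measurable_fun setT Y -> measurable_fun setT G -> (forall w, 0 <= G w)%R ->
  0 <= c ->
  (forall B : set U, measurable B ->
    \int[m]_w (\1_B (Y w) * G w)%:E = c * nu B) ->
  measurable_fun setT f -> (forall y, 0 <= f y)%R ->
  \int[m]_w (f (Y w) * G w)%:E = c * \int[nu]_y (f y)%:E.
Proof.
move=> mY mG G0 c0 H mf f0.
have mfY : measurable_fun setT (f \o Y) by exact: measurableT_comp.
have mh1 := measurable_hypograph mfY.
have mh2 := @measurable_hypograph _ U f mf.
transitivity (\int[m]_w \int[mu]_t (\1_(`[0%R, f (Y w)[%classic) t * G w)%:E).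
  apply: eq_integral => w _; under eq_integral do rewrite EFinM.
  rewrite ge0_integralZr//; first by rewrite integral_indic_itvco.
  all: try by [rewrite lee_fin | move=> t _; rewrite lee_fin |
    apply/measurable_EFinP; exact: measurable_indic].
have mF : measurable_fun setT (fun z : Omega * measurableTypeR R =>
    (\1_(`[0%R, f (Y z.1)[%classic) z.2 * G z.1)%:E).
  apply/measurable_EFinP; apply: measurable_funM => //.
  exact: (measurableT_comp mG measurable_fst).
rewrite (@fubini_tonelli _ _ _ _ _ m mu _ mF); last first.
  by move=> z; rewrite lee_fin mulr_ge0.
transitivity (\int[mu]_t (c * nu (sublevel f t))).
  apply: eq_integral => t _; rewrite -H; last exact: measurable_sublevel.
  by apply: eq_integral => w _; rewrite sublevelE.
have /measurable_EFinP mF2 := mh2.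
have nuE t : nu (sublevel f t) =
    \int[nu]_y (\1_(`[0%R, f y[%classic) t)%:E.
  under eq_integral do rewrite -sublevelE.
  by rewrite integral_indic ?setIT//; exact: measurable_sublevel.
under eq_integral do rewrite nuE.
have mnu := measurable_fun_fubini_tonelli_G (m1 := nu) _ mF2.
rewrite ge0_integralZl//; last 2 first.
- by apply: mnu => z; rewrite lee_fin.
- by move=> t _; apply: integral_ge0 => y _; rewrite lee_fin.
congr (c * _); rewrite -(@fubini_tonelli _ _ _ _ _ nu mu _ mF2); last first.
  by move=> z; rewrite lee_fin.
by apply: eq_integral => y _ /=; rewrite integral_indic_itvco.
Qed.

End density_transfer.

Section independence.
Context d (Omega : measurableType d) {R : realType} (P : probability Omega R).
Local Open Scope ereal_scope.

Lemma prode_nneg (I : Type) (s : seq I) (Q : pred I) (F : I -> \bar R) :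
  (forall i, 0 <= F i) -> 0 <= \prod_(i <- s | Q i) F i.
Proof. by move=> F0; elim/big_ind: _ => //; exact: mule_ge0. Qed.

(* One factor at a time, indicators are replaced by arbitrary functions. *)
Lemma independent_integral_prod n (Y : 'I_n -> {RV P >-> R}) (f : 'I_n -> R -> R) :
  independent_RVs P (fun i => Y i : Omega -> R) ->
  (forall i, measurable_fun setT (f i)) -> (forall i y, 0 <= f i y)%R ->
  \int[P]_w (\prod_(i < n) f i (Y i w))%:E =
  \prod_(i < n) \int[P]_w (f i (Y i w))%:E.
Proof.
move=> indep mf f0.
have mY i : measurable_fun setT (Y i) by [].
have main k (g : 'I_n -> R -> R) :
    (forall i, measurable_fun setT (g i)) -> (forall i y, 0 <= g i y)%R ->
    (forall i : 'I_n, (k <= i)%N -> exists2 B, measurable B & g i = \1_B) ->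
    \int[P]_w (\prod_(i < n) g i (Y i w))%:E =
    \prod_(i < n) \int[P]_w (g i (Y i w))%:E.
  elim: k g => [|k IH] g mg g0 gB.
    have /choice[B HB] : forall i : 'I_n, exists B : set R, measurable B /\ g i = \1_B.
      by move=> i; have [B mB E] := gB i (leq0n _); exists B.
    have mB i : measurable (B i) by case: (HB i).
    have mYB i : measurable (Y i @^-1` B i).
      by rewrite -[X in measurable X]setTI; exact: mY.
    transitivity (P (\bigcap_i (Y i @^-1` B i))).
      rewrite -(setIT (\bigcap_i _)) -integral_indic//; last first.
        exact: fin_bigcap_measurable.
      apply: eq_integral => w _; congr EFin; rewrite indicE.
      have [Hw|Hw] := pselect ((\bigcap_i (Y i @^-1` B i)) w).
        rewrite mem_set//; apply: big1 => i _; case: (HB i) => _ ->.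
        by rewrite indicE mem_set//; exact: Hw.
      rewrite memNset//; apply/eqP; rewrite prodf_seq_eq0; apply/hasP.
      move: Hw => /existsNP[i /not_implyP[_ Hi]].
      exists i; first exact: mem_index_enum.
      by case: (HB i) => _ ->; rewrite /= indicE memNset.
    rewrite indep//; apply: eq_bigr => i _; case: (HB i) => _ ->.
    by rewrite -[X in P X]setIT -integral_indic.
  have [kn|nk] := ltnP k n; last first.
    apply: IH => // i ki; suff : false by [].
    by rewrite -(ltnn i) (leq_trans (ltn_ord i))// (leq_trans nk).
  pose j := Ordinal kn.
  have rest_ge0 w : (0 <= \prod_(i < n | i != j) g i (Y i w))%R.
    exact: prodr_ge0.
  transitivity (\int[P]_w (g j (Y j w) * \prod_(i < n | i != j) g i (Y i w))%:E).
    by apply: eq_integral => w _; rewrite (bigD1 j).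
  rewrite [RHS](bigD1 j)//= muleC.
  have mG : measurable_fun setT (fun w => \prod_(i < n | i != j) g i (Y i w))%R.
    rewrite (_ : (fun w => _) = (fun w => \prod_(i <- [seq i <- index_enum 'I_n | i != j])
       (g i \o Y i) w)%R); last by apply/funext => w; rewrite big_filter.
    by apply: measurable_prod => i _; exact: (measurableT_comp (mg i) (mY i)).
  set c := \prod_(i < n | i != j) _.
  have c0 : 0 <= c.
    by apply: prode_nneg => i; apply: integral_ge0 => w _; rewrite lee_fin.
  (* The product over [i != j] acts as the density [G]. The case of an indicator in place of [g j]
     is the induction hypothesis. *)
  rewrite (integral_density_transfer (nu := distribution P (Y j)) (c := c)
    (mY j) mG)//.
    by rewrite ge0_integral_distribution//; [exact/measurable_EFinP|
      move=> y; rewrite lee_fin].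
  move=> B mB; rewrite /distribution /pushforward.
  pose g' i := if i == j then \1_B else g i.
  have gE i : i != j -> g' i = g i by rewrite /g' => /negPf ->.
  have gjE : g' j = \1_B by rewrite /g' eqxx.
  have IHg : \int[P]_w (\prod_(i < n) g' i (Y i w))%:E =
      \prod_(i < n) \int[P]_w (g' i (Y i w))%:E.
    apply: IH.
    - by move=> i; rewrite /g'; case: ifP => // _; exact: measurable_indic.
    - by move=> i y; rewrite /g'; case: ifP.
    - move=> i ki; rewrite /g'; case: ifPn => [_|ij]; first by exists B.
      apply: gB; rewrite ltn_neqAle ki andbT.
      by apply: contra ij => /eqP E; apply/eqP/val_inj; rewrite /= E.
  transitivity (\int[P]_w (\prod_(i < n) g' i (Y i w))%:E).
    apply: eq_integral => w _; rewrite [in RHS](bigD1 j)//= gjE.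
    by congr (_ * _)%:E; apply: eq_bigr => i ij; rewrite gE.
  rewrite IHg (bigD1 j)//= gjE muleC; congr mule.
    by apply: eq_bigr => i ij; rewrite gE.
  rewrite integral_indic//= ?setIT// -[X in measurable X]setTI.
  exact: mY.
by apply: (main n) => // i; rewrite leqNgt ltn_ord.
Qed.

End independence.

(** * Exponential moments of Gaussian variables and Wiener increments *)

Section gaussian_mgf.
Context {R : realType}.
Local Notation mu := (@lebesgue_measure R).

(** Completing the square: the exponential factor moves the mean, so the total mass of a normal
    density yields the moment generating function. *)
Lemma expR_normal_pdf (s theta y : R) : s != 0 ->
  expR (theta * y) * normal_pdf 0 s y =
  expR (theta ^+ 2 * s ^+ 2 / 2) * normal_pdf (theta * s ^+ 2) s y.
Proof.
move=> s0; rewrite /normal_pdf (negPf s0) /normal_fun.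
rewrite mulrCA [RHS]mulrCA -!expRD; congr (_ * expR _).
by field.
Qed.

Lemma normal_mgf (s theta : R) : s != 0 ->
  (\int[normal_prob 0 s]_y (expR (theta * y))%:E =
   (expR (theta ^+ 2 * s ^+ 2 / 2))%:E)%E.
Proof.
move=> s0; rewrite -[LHS]mul1e.
have mpdf : measurable_fun setT (normal_pdf 0 s) by exact: measurable_normal_pdf.
have mexp : measurable_fun [set: R] (fun y => expR (theta * y)).
  by apply: measurableT_comp => //; exact: measurable_funM.
have mB (B : set R) : measurable B ->
    (\int[mu]_y (\1_B y * normal_pdf 0 s y)%:E = 1 * normal_prob 0 s B)%E.
  move=> mB; rewrite mul1e /normal_prob [RHS]integral_mkcond.
  apply: eq_integral => y _; rewrite patchE indicE.
  by case: (y \in B); rewrite ?mul1r ?mul0r.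
rewrite -(@integral_density_transfer _ _ _ _ _ mu (normal_prob 0 s) id
  (normal_pdf 0 s) 1%E _ (@measurable_id _ _ setT) mpdf
  (normal_pdf_ge0 0 s) lee01 mB mexp (fun y => expR_ge0 _)).
under eq_integral do rewrite expR_normal_pdf// EFinM.
rewrite ge0_integralZl//.
- by rewrite integral_normal_pdf mule1.
- by apply/measurable_EFinP; exact: measurable_normal_pdf.
- by move=> y _; rewrite lee_fin normal_pdf_ge0.
Qed.

End gaussian_mgf.

Section wiener_mgf.
Context d (Omega : measurableType d) {R : realType} (P : probability Omega R).
Variables (T : R) (W : R -> {RV P >-> R}).
Hypothesis WW : wiener_process T W.

Lemma wiener_increment_mgf (s t theta : R) : 0 <= s -> s <= t -> t <= T ->
  (\int[P]_w (expR (theta * (W t w - W s w)))%:E =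
  (expR (theta ^+ 2 * (t - s) / 2))%:E)%E.
Proof.
move=> s0; rewrite le_eqVlt => /predU1P[<- _|st tT].
  under eq_integral do rewrite subrr mulr0.
  by rewrite subrr mulr0 mul0r expR0 integral_cst//= mul1e probability_setT.
have ts0 : 0 < t - s by rewrite subr_gt0.
have sn0 : Num.sqrt (t - s) != 0 by rewrite gt_eqF// sqrtr_gt0.
transitivity (\int[normal_prob 0 (Num.sqrt (t - s))]_y (expR (theta * y))%:E)%E;
  last by rewrite normal_mgf// sqr_sqrtr// ltW.
pose D : {RV P >-> R} := (W t - W s)%R.
have mexp : measurable_fun [set: R] (fun y => expR (theta * y)).
  by apply: measurableT_comp => //; exact: measurable_funM.
have mD : measurable_fun setT (D : Omega -> R) by [].
have HB (B : set (measurableTypeR R)) : measurable B ->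
    (\int[P]_w (\1_B (D w) * 1)%:E =
     1 * normal_prob 0 (Num.sqrt (t - s)) B)%E.
  move=> mB; rewrite mul1e -(wiener_increment WW s0 st tT mB).
  under eq_integral do rewrite mulr1.
  rewrite integral_indic//= ?setIT// -[X in measurable X]setTI.
  exact: (mD measurableT _ mB).
have := @integral_density_transfer _ _ _ _ _ P (normal_prob 0 (Num.sqrt (t - s)))
  D (cst 1) 1%E _ mD (measurable_cst _) (fun=> ler01) lee01 HB mexp (fun y => expR_ge0 _).
rewrite mul1e => <-.
by under [RHS]eq_integral do rewrite mulr1.
Qed.

Lemma wiener_sum_mgf (n : nat) (t : nat -> R) (c : nat -> R) (theta : R) :
  0 <= t 0%N -> (forall i, (i < n)%N -> t i <= t i.+1) -> t n <= T ->
  (\int[P]_w (expR (theta * \sum_(i < n) c i * (W (t i.+1) w - W (t i) w)))%:E =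
  (expR (theta ^+ 2 * (\sum_(i < n) c i ^+ 2 * (t i.+1 - t i)) / 2))%:E)%E.
Proof.
move=> t0 tS tn.
pose Y (i : 'I_n) : {RV P >-> R} := (W (t i.+1) - W (t i))%R.
have indep : independent_RVs P (fun i => Y i : Omega -> R).
  exact: (wiener_independent WW t0 tS tn).
pose f (i : 'I_n) (y : R) := expR (theta * c i * y).
have mf i : measurable_fun setT (f i).
  by apply: measurableT_comp => //; exact: measurable_funM.
have mono i j : (i <= j)%N -> (j <= n)%N -> t i <= t j.
  move=> ij; elim: j ij => [|j IH]; first by rewrite leqn0 => /eqP ->.
  rewrite leq_eqVlt => /predU1P[->//|]; rewrite ltnS => ij jn.
  exact: le_trans (IH ij (ltnW jn)) (tS _ jn).
transitivity (\int[P]_w (\prod_(i < n) f i (Y i w))%:E)%E.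
  apply: eq_integral => w _; congr EFin; rewrite mulr_sumr expR_sum.
  by apply: eq_bigr => i _; rewrite mulrA.
rewrite independent_integral_prod//; last by move=> i y; exact: expR_ge0.
rewrite mulr_sumr mulr_suml expR_sum -prodEFin; apply: eq_bigr => i _.
rewrite /f /Y /=.
rewrite wiener_increment_mgf.
- by congr (expR _)%:E; rewrite exprMn !mulrA.
- by apply: le_trans t0 _; apply: mono => //; exact: ltnW.
- exact: tS.
- by apply: le_trans tn; exact: mono.
Qed.

End wiener_mgf.

(** * Tails of Wiener integrals *)

Section step_functions.
Context {R : realType}.
Local Notation mu := (@lebesgue_measure R).

(** Clamping each [t j] to [[t a, t b]] before applying [g] turns the left-hand side into a
    telescoping sum. *)
Lemma telescope_itv (n : nat) (t : nat -> R) (g : R -> R) (a b : nat) :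
  {in [pred i | (i <= n)%N] &, {homo t : i j / (i <= j)%N >-> i <= j}} ->
  (a <= n)%N -> (b <= n)%N -> t a <= t b ->
  \sum_(j < n) \1_(`]t a, t b]) (t j.+1) * (g (t j.+1) - g (t j)) =
  g (t b) - g (t a).
Proof.
move=> mono an bn ab.
have mono' i j : (j <= n)%N -> (i <= j)%N -> t i <= t j.
  by move=> jn ij; apply: mono => //; rewrite inE ?(leq_trans ij).
pose G j := g (Num.max (t a) (Num.min (t b) (t j))).
transitivity (\sum_(0 <= j < n) (G j.+1 - G j)); last first.
  rewrite telescope_sumr// /G (min_l (mono' _ _ (leqnn n) bn)) (max_r ab).
  rewrite (min_r (mono' _ _ bn (leq0n b))).
  by rewrite (max_l (mono' _ _ an (leq0n a))).
rewrite big_mkord; apply: eq_bigr => j _; have jn := ltn_ord j.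
(* The endpoints [t a] and [t b] are themselves partition points, so neither lies strictly between
   [t j] and [t j.+1]. *)
have gap c : (c <= n)%N -> t c < t j.+1 -> t c <= t j.
  move=> cn; case: (leqP c j) => [cj _|jc]; first exact: mono' (ltnW jn) cj.
  by rewrite ltNge (mono' _ _ cn jc).
have tj : t j <= t j.+1 by exact: mono'.
rewrite /G indicE; case: (leP (t j.+1) (t a)) => [ja|aj].
  rewrite memNset/=; last by rewrite in_itv/= ltNge ja.
  rewrite mul0r (min_r (le_trans ja ab)) (max_l ja).
  by rewrite (min_r (le_trans (le_trans tj ja) ab)) (max_l (le_trans tj ja)) subrr.
have aj' := gap _ an aj.
case: (leP (t j.+1) (t b)) => [jb|bj].
  rewrite mem_set/=; last by rewrite in_itv/= aj.
  by rewrite mul1r (max_r (ltW aj)) (min_r (le_trans tj jb)) (max_r aj').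
rewrite memNset/=; last by rewrite in_itv/= aj/= leNgt bj.
by rewrite mul0r (min_l (gap _ bn bj)) subrr.
Qed.

(** Quantifying over [g] lets one partition serve twice: a Wiener path as [g] rewrites the step
    integral, and the truth value of [x <= y] as [g y] rewrites the step function itself. *)
Lemma step_fun_refine (T : R) (h : seq (R * (R * R))) :
  0 <= T -> step_within T h ->
  exists n, exists t : nat -> R,
  [/\ 0 <= t 0%N, {in [pred i | (i <= n)%N] &, {homo t : i j / (i <= j)%N >-> i <= j}},
    t n <= T & forall g : R -> R,
    \sum_(k <- h) k.1 * (g k.2.2 - g k.2.1) =
    \sum_(j < n) step_fun h (t j.+1) * (g (t j.+1) - g (t j))].
Proof.
move=> T0 /allP hT.
pose s0 := 0 :: T :: flatten [seq [:: k.2.1; k.2.2] | k <- h].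
pose s := sort <=%R s0.
have s0T x : x \in s0 -> 0 <= x <= T.
  rewrite !inE => /or3P[/eqP ->|/eqP ->|/flattenP[l /mapP[k kh ->]]].
  - by rewrite lexx.
  - by rewrite lexx andbT.
  - have /and3P[l0 lr rT] := hT _ kh.
    rewrite !inE => /orP[] /eqP ->; first by rewrite l0 (le_trans lr).
    by rewrite rT andbT (le_trans l0).
have ss : size s = (size s0).-1.+1 by rewrite size_sort.
have ns i : (i <= (size s0).-1)%N -> nth 0 s i \in s0.
  by move=> i_s; rewrite -(mem_sort <=%R) mem_nth// -/s ss ltnS.
exists (size s0).-1, (nth 0 s); split.
- by have /andP[] := s0T _ (ns _ (leq0n _)).
- move=> i j; rewrite !inE => iN jN ij.
  apply: (sorted_leq_nth le_trans lexx) => //; rewrite ?inE -/s ?ss ?ltnS//.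
  exact: sort_le_sorted.
- by have /andP[] := s0T _ (ns _ (leqnn _)).
move=> g; under [RHS]eq_bigr do rewrite /step_fun mulr_suml.
rewrite exchange_big/=; apply: eq_big_seq => k kh.
under eq_bigr do rewrite -mulrA.
rewrite -mulr_sumr; congr (_ * _).
have mem_k x : x \in [:: k.2.1; k.2.2] -> exists2 i, (i <= (size s0).-1)%N & nth 0 s i = x.
  move=> xk; have xs : x \in s.
    rewrite mem_sort !inE; apply/or3P/Or33/flattenP.
    by exists [:: k.2.1; k.2.2] => //; apply/mapP; exists k.
  by exists (index x s); [rewrite -ltnS -ss index_mem|exact: nth_index].
have [a an aE] : exists2 i, (i <= (size s0).-1)%N & nth 0 s i = k.2.1.
  by apply: mem_k; rewrite !inE eqxx.
have [b bn bE] : exists2 i, (i <= (size s0).-1)%N & nth 0 s i = k.2.2.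
  by apply: mem_k; rewrite !inE eqxx orbT.
rewrite -aE -bE telescope_itv//.
- move=> i j; rewrite !inE => iN jN ij.
  apply: (sorted_leq_nth le_trans lexx) => //; rewrite ?inE -/s ?ss ?ltnS//.
  exact: sort_le_sorted.
- by rewrite aE bE; have /and3P[] := hT _ kh.
Qed.

Lemma indic_itvoc (l r x : R) : l <= r ->
  \1_(`]l, r]) x = (x <= r)%R%:R - (x <= l)%R%:R :> R.
Proof.
move=> lr; rewrite indicE mem_setE in_itv/= ltNge.
case: (leP x l) => [xl|]; first by rewrite (le_trans xl lr) subrr.
by rewrite subr0.
Qed.

(** Applied to the truth value of [x <= y], the refinement identity expands the step function over
    disjoint intervals, so at most one term is nonzero at [x] and squares are taken term by term.
    The result is the variance occurring in [wiener_sum_mgf], as in the Ito isometry. *)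
Lemma step_fun_sqr_integral (n : nat) (t : nat -> R) (h : seq (R * (R * R))) :
  {in [pred i | (i <= n)%N] &, {homo t : i j / (i <= j)%N >-> i <= j}} ->
  (forall k, k \in h -> k.2.1 <= k.2.2) ->
  (forall g : R -> R, \sum_(k <- h) k.1 * (g k.2.2 - g k.2.1) =
    \sum_(j < n) step_fun h (t j.+1) * (g (t j.+1) - g (t j))) ->
  (\int[mu]_x (step_fun h x ^+ 2)%:E =
   (\sum_(j < n) step_fun h (t j.+1) ^+ 2 * (t j.+1 - t j))%:E)%E.
Proof.
move=> mono hlr refine.
have mono' i j : (j <= n)%N -> (i <= j)%N -> t i <= t j.
  by move=> jn ij; apply: mono => //; rewrite inE ?(leq_trans ij).
have tS (j : 'I_n) : t j <= t j.+1 by apply: mono'.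
have sE x : step_fun h x =
    \sum_(j < n) step_fun h (t j.+1) * \1_(`]t j, t j.+1]) x.
  have := refine (fun y => (x <= y)%R%:R).
  under [in RHS]eq_bigr do rewrite -indic_itvoc//.
  move=> <-; apply: eq_big_seq => k kh.
  by rewrite indic_itvoc// hlr.
have s2E x : step_fun h x ^+ 2 =
    \sum_(j < n) step_fun h (t j.+1) ^+ 2 * \1_(`]t j, t j.+1]) x.
  rewrite sE; case: (pickP [pred j : 'I_n | t j < x <= t j.+1]) => [j /= jx|none].
    have other (i : 'I_n) : i != j -> \1_(`]t i, t i.+1]) x = 0 :> R.
      move=> ij; rewrite indicE memNset//= in_itv/= => /andP[ix xi].
      case/andP: jx => jx xj.
      case: (ltngtP i j) => [ij'|ji'|/val_inj E]; last by rewrite E eqxx in ij.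
        have := mono' _ _ (ltnW (ltn_ord j)) ij'.
        by rewrite leNgt (lt_le_trans jx xi).
      have := mono' _ _ (ltnW (ltn_ord i)) ji'.
      by rewrite leNgt (lt_le_trans ix xj).
    have self : \1_(`]t j, t j.+1]) x = 1 :> R by rewrite indicE mem_set//= in_itv.
    rewrite [in LHS](bigD1 j)//= [in RHS](bigD1 j)//= self !mulr1.
    rewrite [X in (_ + X) ^+ 2]big1 ?addr0; last by move=> i /other ->; rewrite mulr0.
    by rewrite [X in _ + X]big1 ?addr0// => i /other ->; rewrite mulr0.
  have zero (i : 'I_n) : \1_(`]t i, t i.+1]) x = 0 :> R.
    rewrite indicE memNset//= in_itv/=; have := none i; rewrite /= => ->.
    by [].
  rewrite big1 => [|i _]; last by rewrite zero mulr0.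
  by rewrite big1 ?expr0n// => i _; rewrite zero mulr0.
under eq_integral do rewrite s2E -sumEFin.
have mi (j : 'I_n) : measurable_fun [set: R] (fun x =>
    (step_fun h (t j.+1) ^+ 2 * \1_(`]t j, t j.+1]) x)%:E).
  apply/measurable_EFinP; apply: measurable_funM; first exact: measurable_cst.
  exact: measurable_indic.
rewrite ge0_integral_sum//; last first.
  by move=> j x _; rewrite lee_fin mulr_ge0 ?sqr_ge0.
rewrite -sumEFin; apply: eq_bigr => j _.
under eq_integral do rewrite EFinM.
rewrite ge0_integralZl//=.
- rewrite integral_indic//= setIT lebesgue_measure_itv/= lte_fin.
  case: ltP => [_|ji]; first by rewrite -EFinB -EFinM.
  rewrite mule0; congr EFin; rewrite (_ : t j = t j.+1) ?subrr ?mulr0//.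
  by apply/le_anti; rewrite tS ji.
- by apply/measurable_EFinP; exact: measurable_indic.
- by rewrite lee_fin sqr_ge0.
Qed.

Lemma measurable_step_fun (h : seq (R * (R * R))) :
  measurable_fun [set: R] (step_fun h).
Proof.
by apply: measurable_sum => k; apply: measurable_funM => //.
Qed.

End step_functions.

Section step_integral_tail.
Context d (Omega : measurableType d) {R : realType} (P : probability Omega R).
Variables (T : R) (W : R -> {RV P >-> R}).
Hypothesis WW : wiener_process T W.
Local Notation mu := (@lebesgue_measure R).

Lemma measurable_step_integral (h : seq (R * (R * R))) :
  measurable_fun [set: Omega] (step_integral W h).
Proof.
apply: measurable_sum => k; apply: measurable_funM => //.
exact: measurable_funB.
Qed.

(** Chernoff's bound at the two parameters [sigma^-1] and [- sigma^-1], where the exponential moment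
    is at most [expR (1/2)]. On the event, [expR (- u)] times the sum of the two exponentials is at
    least [1]. *)
Lemma step_integral_tail (h : seq (R * (R * R))) (sigma u : R) :
  0 <= T -> step_within T h -> 0 < sigma ->
  (\int[mu]_x (step_fun h x ^+ 2)%:E <= (sigma ^+ 2)%:E)%E ->
  (P [set w | (u * sigma < `|step_integral W h w|)%R] <=
    (2 * expR (1/2 - u))%:E)%E.
Proof.
move=> T0 hT s0 hs.
have [n [t [t0 mono tn refine]]] := step_fun_refine T0 hT.
have hlr k : k \in h -> k.2.1 <= k.2.2.
  by move=> kh; have /and3P[] := allP hT _ kh.
rewrite (step_fun_sqr_integral mono hlr refine) in hs.
set V := \sum_(j < n) _ in hs; rewrite lee_fin in hs.
have mgf theta : (\int[P]_w (expR (theta * step_integral W h w))%:E =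
    (expR (theta ^+ 2 * V / 2))%:E)%E.
  rewrite -(wiener_sum_mgf WW (fun i => step_fun h (t i.+1)) theta t0 _ tn).
    apply: eq_integral => w _; congr (expR (_ * _))%:E.
    exact: (refine (fun y => W y w)).
  by move=> i iN; apply: mono => //; rewrite inE ltnW.
have mgf_le theta : theta ^+ 2 = sigma ^- 2 ->
    (\int[P]_w (expR (theta * step_integral W h w))%:E <= (expR (1/2))%:E)%E.
  move=> th; rewrite mgf lee_fin ler_expR ler_pM2r ?invr_gt0// th.
  by rewrite mulrC ler_pdivrMr ?mul1r// exprn_gt0.
have mS := measurable_step_integral h.
have mexp theta : measurable_fun setT
    (fun w => (expR (theta * step_integral W h w))%:E).
  by apply/measurable_EFinP; apply: measurableT_comp => //; exact: measurable_funM.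
pose A := [set w | (u * sigma < `|step_integral W h w|)%R].
have mA : measurable A.
  rewrite (_ : A = (fun w => `|step_integral W h w|) @^-1` `]u * sigma, +oo[%classic).
    rewrite -[X in measurable X]setTI.
    have m : measurable_fun setT (fun w => `|step_integral W h w|).
      exact: measurableT_comp.
    exact: m.
  by apply/seteqP; split => w /=; rewrite in_itv/= andbT.
have -> : (2 * expR (1/2 - u) = expR (- u) * (expR (1/2) + expR (1/2)))%R.
  by rewrite expRD; ring.
rewrite EFinM EFinD.
apply: le_trans (lee_wpmul2l _ (leeD (mgf_le sigma^-1 _) (mgf_le (- sigma^-1) _))).
- rewrite -ge0_integralD//=; try by move=> w _; rewrite lee_fin expR_ge0.
  rewrite -ge0_integralZl//=.
  + rewrite -[X in P X]setIT -integral_indic//.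
    apply: ge0_le_integral => //=.
    all: try by [apply/measurable_EFinP; exact: measurable_indic |
      move=> w _; rewrite mule_ge0 ?adde_ge0// lee_fin expR_ge0 |
      apply: measurable_funeM; exact: emeasurable_funD].
    move=> w _; rewrite indicE -EFinD -EFinM lee_fin.
    have e0 x : 0 <= expR x :> R by exact: expR_ge0.
    case: (boolP (w \in _)) => [|_]; last by rewrite mulr_ge0 ?addr_ge0.
    rewrite inE /= => Aw.
    rewrite expRN mulrC ler_pdivlMr ?expR_gt0// mul1r.
    apply: (@le_trans _ _ (expR (`|step_integral W h w| / sigma))).
      by rewrite ler_expR ler_pdivlMr// ltW.
    case: (ger0P (step_integral W h w)) => _; first by rewrite mulrC lerDl.
    by rewrite !mulNr [_ / sigma]mulrC lerDr.
  all: try by [exact: emeasurable_funD |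
    move=> w _; rewrite adde_ge0// lee_fin expR_ge0 | rewrite lee_fin expR_ge0].
- by rewrite exprVn.
- by rewrite sqrrN exprVn.
Qed.

End step_integral_tail.

(** * Passage from step functions to L^2 limits *)

Section L2_limits.
Context d (Omega : measurableType d) {R : realType}.
Variable m : {measure set Omega -> \bar R}.

Lemma Lnorm2_cvg0 (D : nat -> Omega -> R) (e : R) : 0 < e ->
  Lnorm m 2%:E (EFin \o D n) @[n --> \oo] --> 0%E ->
  exists N : nat, forall n, (N <= n)%N -> (\int[m]_w (D n w ^+ 2)%:E <= (e ^+ 2)%:E)%E.
Proof.
move=> e0 D0.
have /= : \forall n \near \oo, (Lnorm m 2%:E (EFin \o D n) < e%:E)%E.
  apply: (D0 [set x | (x < e%:E)%E]).
  by apply: open_nbhs_nbhs; split; [exact: open_ereal_lt_ereal|rewrite /= lte_fin].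
move=> [N _ HN]; exists N => n Nn.
rewrite -sqr_Lnorm2 expr2 EFinM.
by apply: lee_pmul; rewrite ?Lnorm_ge0// ltW//; exact: HN.
Qed.

Lemma measurable_gt_set (D : Omega -> R) (e : R) : measurable_fun setT D ->
  measurable [set w | e < D w].
Proof.
move=> mD; rewrite (_ : [set w | _] = D @^-1` `]e, +oo[%classic).
  by rewrite -[X in measurable X]setTI; exact: mD.
by apply/seteqP; split => w /=; rewrite in_itv/= andbT.
Qed.

Lemma sqr_markov (D : Omega -> R) (e : R) : measurable_fun setT D -> 0 < e ->
  (m [set w | (e < `|D w|)%R] <= (e ^- 2)%:E * \int[m]_w (D w ^+ 2)%:E)%E.
Proof.
move=> mD e0.
have mA : measurable [set w | e < `|D w|].
  by apply: measurable_gt_set; exact: measurableT_comp.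
have mD2 : measurable_fun setT (fun w => (D w ^+ 2)%:E).
  by apply/measurable_EFinP; exact: measurable_funX.
have e2 : 0 <= e ^- 2 by rewrite invr_ge0 exprn_ge0// ltW.
rewrite -(ge0_integralZl m measurableT mD2); last 2 first.
- by move=> w _; rewrite lee_fin sqr_ge0.
- by rewrite lee_fin.
rewrite -[X in m X]setIT -integral_indic//.
apply: ge0_le_integral; first exact: measurableT.
- by move=> w _; rewrite lee_fin.
- by apply/measurable_EFinP; exact: measurable_indic.
- exact: measurable_funeM.
move=> w _; rewrite -EFinM lee_fin indicE.
case: (boolP (w \in _)) => [|_]; last by rewrite mulr_ge0 ?sqr_ge0.
rewrite inE /= => ew; rewrite mulrC ler_pdivlMr ?exprn_gt0// mul1r.
by rewrite -[X in _ <= X]real_normK ?num_real// lerXn2r ?nnegrE// ltW.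
Qed.

Lemma integral_sqr3_le (f g h : Omega -> R) :
  measurable_fun setT f -> measurable_fun setT g -> measurable_fun setT h ->
  (\int[m]_x ((f x + g x + h x) ^+ 2)%:E <=
   3%:E * (\int[m]_x (f x ^+ 2)%:E + \int[m]_x (g x ^+ 2)%:E +
           \int[m]_x (h x ^+ 2)%:E))%E.
Proof.
move=> mf mg mh.
have ms (k : Omega -> R) : measurable_fun setT k ->
    measurable_fun setT (fun x => (k x ^+ 2)%:E).
  by move=> mk; apply/measurable_EFinP; exact: measurable_funX.
have s0 (k : Omega -> R) x : setT x -> (0 <= (k x ^+ 2)%:E)%E.
  by move=> _; rewrite lee_fin sqr_ge0.
rewrite -(ge0_integralD m measurableT (s0 f) (ms _ mf) (s0 g) (ms _ mg)).
have mfg : measurable_fun setT (fun x => ((f x ^+ 2)%:E + (g x ^+ 2)%:E)%E).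
  by apply: emeasurable_funD; exact: ms.
have fg0 x : setT x -> (0 <= (f x ^+ 2)%:E + (g x ^+ 2)%:E)%E.
  by move=> _; rewrite adde_ge0// lee_fin sqr_ge0.
rewrite -(ge0_integralD m measurableT fg0 mfg (s0 h) (ms _ mh)).
have mfgh : measurable_fun setT
    (fun x => ((f x ^+ 2)%:E + (g x ^+ 2)%:E + (h x ^+ 2)%:E)%E).
  by apply: emeasurable_funD => //; exact: ms.
rewrite -(ge0_integralZl m measurableT mfgh)//; last first.
  by move=> x _; rewrite !adde_ge0// lee_fin sqr_ge0.
apply: ge0_le_integral; first exact: measurableT.
- by move=> x _; rewrite lee_fin sqr_ge0.
- by apply: ms; apply: measurable_funD => //; exact: measurable_funD.
- exact: measurable_funeM.
move=> x _; rewrite -!EFinD -EFinM lee_fin.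
have := sqr_ge0 (f x - g x); have := sqr_ge0 (f x - h x).
have := sqr_ge0 (g x - h x); nra.
Qed.

End L2_limits.

Section wiener_integral_tail.
Context d (Omega : measurableType d) {R : realType} (P : probability Omega R).
Variables (T : R) (W : R -> {RV P >-> R}).
Hypothesis WW : wiener_process T W.
Local Notation mu := (@lebesgue_measure R).

Definition step_opp (h : seq (R * (R * R))) := [seq (- k.1, k.2) | k <- h].

Lemma step_fun_sub h1 h2 x :
  step_fun (h1 ++ step_opp h2) x = step_fun h1 x - step_fun h2 x.
Proof.
rewrite /step_fun big_cat big_map/=; congr (_ + _).
by rewrite -sumrN; apply: eq_bigr => k _; rewrite mulNr.
Qed.

Lemma step_integral_sub h1 h2 w : step_integral W (h1 ++ step_opp h2) w =
  step_integral W h1 w - step_integral W h2 w.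
Proof.
rewrite /step_integral big_cat big_map/=; congr (_ + _).
by rewrite -sumrN; apply: eq_bigr => k _; rewrite mulNr.
Qed.

Lemma step_within_le (t : R) h : t <= T -> step_within t h -> step_within T h.
Proof.
move=> tT /allP H; apply/allP => k /H /and3P[-> -> kt] /=.
exact: le_trans tT.
Qed.

Lemma step_within_sub h1 h2 : step_within T h1 -> step_within T h2 ->
  step_within T (h1 ++ step_opp h2).
Proof.
by move=> h1T h2T; rewrite /step_within all_cat; apply/andP; split => //;
  rewrite all_map.
Qed.

Lemma step_fun_restrict (t : R) h : step_within t h -> step_fun h \_ `[0, t] = step_fun h.
Proof.
move=> /allP ht; apply/funext => x; rewrite patchE; case: ifPn => // xt.
apply/esym; rewrite /step_fun; apply: big1_seq => k /= kh.
have /and3P[l0 _ rt] := ht _ kh.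
rewrite indicE memNset ?mulr0//= in_itv/= => /andP[lx xr].
move: xt; rewrite mem_setE in_itv/= => /negP; apply.
by rewrite (le_trans l0 (ltW lx)) (le_trans xr).
Qed.

Lemma restrict_sub_step (t : R) (f : R -> R) h : step_within t h ->
  (fun x => f x - step_fun h x) \_ `[0, t] = (fun x => (f \_ `[0, t]) x - step_fun h x).
Proof.
move=> ht; apply/funext => x; rewrite -[in RHS](step_fun_restrict ht) !patchE.
by case: ifPn => // _; rewrite subr0.
Qed.

(** The threshold [4 * u * sigma] is shared out: [2 * u * sigma] for an approximating step integral,
    whose integrand has norm at most [2 * sigma], and [u * sigma] for each of the two approximation
    errors, which Chebyshev's inequality makes improbable. The total error probability [e] is
    arbitrary, so the tail constant is not degraded. *)
Lemma wiener_integral_increment_tail (s t : R) (f g : R -> R)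
    (X Y : {RV P >-> R}) (sigma u : R) :
  0 <= T -> s <= T -> t <= T -> 0 < sigma -> 0 < u ->
  is_wiener_integral W t f X -> is_wiener_integral W s g Y ->
  (\int[mu]_x (((f \_ `[0%R, t]) x - (g \_ `[0%R, s]) x) ^+ 2)%:E
    <= (sigma ^+ 2)%:E)%E ->
  (P [set w | (4 * u * sigma < `|X w - Y w|)%R] <= (2 * expR (1/2 - u))%:E)%E.
Proof.
move=> T0 sT tT sig0 u0 [fL [hf [hft hff hfX]]] [gL [hg [hgs hgg hgY]]] fgs.
set ft := f \_ `[0, t] in fgs; set gs := g \_ `[0, s] in fgs.
have mft : measurable_fun setT ft by have := sub_Lfun_mfun fL; rewrite inE.
have mgs : measurable_fun setT gs by have := sub_Lfun_mfun gL; rewrite inE.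
have hff' : Lnorm mu 2%:E (EFin \o (fun x => ft x - step_fun (hf n) x))
    @[n --> \oo] --> 0%E.
  by under eq_fun do rewrite /ft -restrict_sub_step//.
have hgg' : Lnorm mu 2%:E (EFin \o (fun x => gs x - step_fun (hg n) x))
    @[n --> \oo] --> 0%E.
  by under eq_fun do rewrite /gs -restrict_sub_step//.
apply/lee_addgt0Pr => e e0.
have us0 : 0 < u * sigma by exact: mulr_gt0.
(* Chosen so that Chebyshev's bound [dl ^+ 2 / (u * sigma) ^+ 2] equals [e / 2]. *)
pose dl := u * sigma * Num.sqrt (e / 2).
have dl0 : 0 < dl by rewrite mulr_gt0// sqrtr_gt0 divr_gt0.
(* With errors of norm at most [sigma / 3] the three-term bound is 3 (1 + 1/9 + 1/9) sigma^2 =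
   (11/3) sigma^2, which is below (2 sigma)^2. *)
have s30 : 0 < sigma / 3 by rewrite divr_gt0.
have [N1 HN1] := Lnorm2_cvg0 s30 hff'.
have [N2 HN2] := Lnorm2_cvg0 s30 hgg'.
have [N3 HN3] := @Lnorm2_cvg0 _ _ _ P (fun n w => X w - step_integral W (hf n) w) _ dl0 hfX.
have [N4 HN4] := @Lnorm2_cvg0 _ _ _ P (fun n w => Y w - step_integral W (hg n) w) _ dl0 hgY.
pose n := (N1 + N2 + (N3 + N4))%N.
have {}HN1 := HN1 n (leq_trans (leq_addr _ _) (leq_addr _ _)).
have {}HN2 := HN2 n (leq_trans (leq_addl _ _) (leq_addr _ _)).
have {}HN3 := HN3 n (leq_trans (leq_addr _ _) (leq_addl _ _)).
have {}HN4 := HN4 n (leq_trans (leq_addl _ _) (leq_addl _ _)).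
pose h := hf n ++ step_opp (hg n).
have hT : step_within T h.
  by apply: step_within_sub; [exact: step_within_le (hft n)|exact: step_within_le (hgs n)].
have hint : (\int[mu]_x (step_fun h x ^+ 2)%:E <= ((2 * sigma) ^+ 2)%:E)%E.
  pose A x := ft x - gs x.
  pose B x := step_fun (hf n) x - ft x.
  pose C x := gs x - step_fun (hg n) x.
  have -> : (\int[mu]_x (step_fun h x ^+ 2)%:E =
      \int[mu]_x ((A x + B x + C x) ^+ 2)%:E)%E.
    apply: eq_integral => x _; rewrite step_fun_sub; congr ((_ ^+ 2)%:E).
    by rewrite /A /B /C; ring.
  have mA : measurable_fun setT A by exact: measurable_funB.
  have mB : measurable_fun setT B.
    by apply: measurable_funB => //; exact: measurable_step_fun.
  have mC : measurable_fun setT C.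
    by apply: measurable_funB => //; exact: measurable_step_fun.
  apply: le_trans (integral_sqr3_le mu mA mB mC) _.
  have HB : (\int[mu]_x (B x ^+ 2)%:E <= ((sigma / 3) ^+ 2)%:E)%E.
    apply: le_trans HN1; rewrite le_eqVlt; apply/orP; left; apply/eqP.
    by apply: eq_integral => x _; rewrite /B -sqrrN opprB.
  apply: (@le_trans _ _ (3%:E * ((sigma ^+ 2)%:E + ((sigma / 3) ^+ 2)%:E +
      ((sigma / 3) ^+ 2)%:E))%E).
    by apply: lee_wpmul2l => //; apply: leeD => //; apply: leeD.
  rewrite -!EFinD -EFinM lee_fin; have := sqr_ge0 sigma; nra.
have mX : measurable_fun setT (X : Omega -> R) by [].
have mY : measurable_fun setT (Y : Omega -> R) by [].
have mS k := measurable_step_integral W k.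
pose DX w := X w - step_integral W (hf n) w.
pose DY w := Y w - step_integral W (hg n) w.
have mDX : measurable_fun setT DX by exact: measurable_funB.
have mDY : measurable_fun setT DY by exact: measurable_funB.
pose EX := [set w | u * sigma < `|DX w|].
pose EY := [set w | u * sigma < `|DY w|].
pose ES := [set w | u * (2 * sigma) < `|step_integral W h w|].
have mEX : measurable EX by apply: measurable_gt_set; exact: measurableT_comp.
have mEY : measurable EY by apply: measurable_gt_set; exact: measurableT_comp.
have mES : measurable ES by apply: measurable_gt_set; exact: measurableT_comp.
have cheb (D : Omega -> R) : measurable_fun setT D ->
    (\int[P]_w (D w ^+ 2)%:E <= (dl ^+ 2)%:E)%E ->
    (P [set w | (u * sigma < `|D w|)%R] <= (e / 2)%:E)%E.
  move=> mD HD; apply: le_trans (sqr_markov P mD us0) _.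
  apply: (@le_trans _ _ (((u * sigma) ^- 2)%:E * (dl ^+ 2)%:E)%E).
    by apply: lee_wpmul2l => //; rewrite lee_fin invr_ge0 sqr_ge0.
  rewrite -EFinM lee_fin /dl [(_ * Num.sqrt _) ^+ 2]exprMn mulrA mulVf ?mul1r; last first.
    by rewrite expf_neq0// gt_eqF.
  by rewrite sqr_sqrtr// divr_ge0// ltW.
apply: (@le_trans _ _ (P (ES `|` (EX `|` EY)))).
  apply: le_measure; rewrite ?inE.
  - apply: measurable_gt_set; apply: measurableT_comp => //; exact: measurable_funB.
  - by apply: measurableU => //; exact: measurableU.
  move=> w /= Hw; apply: contrapT => /not_orP[nS /not_orP[nX nY]].
  move/negP: nS; move/negP: nX; move/negP: nY; rewrite -!leNgt => nY nX nS.
  move: Hw; apply/negP; rewrite -leNgt.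
  have -> : X w - Y w = DX w - DY w + step_integral W h w.
    by rewrite /DX /DY step_integral_sub; ring.
  apply: le_trans (ler_normD _ _) _.
  apply: (@le_trans _ _ ((`|DX w| + `|DY w|) + `|step_integral W h w|)).
    by rewrite lerD2r ler_normB.
  lra.
apply: le_trans (measureU2 _ mES (measurableU _ _ mEX mEY)) _.
apply: leeD.
  by apply: (step_integral_tail WW) => //; rewrite mulr_gt0.
apply: le_trans (measureU2 _ mEX mEY) _.
rewrite [X in X%:E](splitr e) EFinD; apply: leeD; exact: cheb.
Qed.

End wiener_integral_tail.

(** * The Kolmogorov-Chentsov theorem *)

Section dyadic_chaining.
Context {R : realType}.

Definition dyadic (n k : nat) : R := k%:R / 2 ^+ n.

Definition dyadic_index (n : nat) (y : R) : nat := Num.truncn (2 ^+ n * y).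

Definition dyadic_floor (n : nat) (y : R) : R := dyadic n (dyadic_index n y).

Let pow2_gt0 n : 0 < 2 ^+ n :> R. Proof. exact: exprn_gt0. Qed.

Lemma dyadic_index_itv n y : 0 <= y ->
  (dyadic_index n y)%:R <= 2 ^+ n * y < (dyadic_index n y).+1%:R.
Proof. by move=> y0; apply: truncn_itv; rewrite mulr_ge0// ltW. Qed.

Lemma dyadic_floor_le n y : 0 <= y -> dyadic_floor n y <= y.
Proof.
move=> y0; have /andP[h _] := dyadic_index_itv n y0.
by rewrite /dyadic_floor /dyadic ler_pdivrMr// mulrC.
Qed.

Lemma dyadic_floor_gt n y : 0 <= y -> y - dyadic_floor n y < 2 ^- n.
Proof.
move=> y0; have /andP[_ h] := dyadic_index_itv n y0.
rewrite ltrBlDl /dyadic_floor /dyadic -[X in _ < _ + X]mul1r -mulrDl.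
by rewrite ltr_pdivlMr// natr1 mulrC.
Qed.

Lemma dyadic_floor_ge0 n y : 0 <= dyadic_floor n y.
Proof. by rewrite /dyadic_floor /dyadic divr_ge0// ltW. Qed.

Lemma dyadic_index_le n y : 0 <= y <= 1 -> (dyadic_index n y <= 2 ^ n)%N.
Proof.
move=> /andP[y0 y1]; have /andP[h _] := dyadic_index_itv n y0.
rewrite -(ler_nat R) natrX; apply: le_trans h _.
by rewrite -[leRHS]mulr1 ler_wpM2l// ltW.
Qed.

Lemma dyadic_indexS n y : 0 <= y ->
  dyadic_index n.+1 y = (dyadic_index n y).*2 \/
  dyadic_index n.+1 y = (dyadic_index n y).*2.+1.
Proof.
move=> y0; have /andP[h1 h2] := dyadic_index_itv n y0.
have /andP[h3 h4] := dyadic_index_itv n.+1 y0.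
set k := dyadic_index n y in h1 h2 *; set k' := dyadic_index n.+1 y in h3 h4 *.
have k2k' : (k.*2 <= k')%N.
  rewrite -ltnS -(ltr_nat R) -muln2 natrM; apply: le_lt_trans h4.
  by rewrite exprS mulrC -mulrA ler_pM2l.
have k'k2 : (k' <= k.*2.+1)%N.
  rewrite -ltnS -(ltr_nat R); apply: (le_lt_trans h3).
  by rewrite -doubleS -mul2n natrM exprS -mulrA ltr_pM2l.
move: k'k2; rewrite leq_eqVlt => /predU1P[->|]; first by right.
by rewrite ltnS => k'k2; left; apply/eqP; rewrite eqn_leq k2k' k'k2.
Qed.

Lemma dyadic_double n k : dyadic n.+1 k.*2 = dyadic n k.
Proof.
by rewrite /dyadic -mul2n natrM exprS invfM mulrACA mulfV ?mul1r.
Qed.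

Section increments.
Variables (z : R -> R) (S rho : R).
Hypotheses (S0 : 0 <= S) (rho0 : 0 < rho) (rho1 : rho < 1).
Hypothesis zS : forall n k, (k < 2 ^ n)%N ->
  `|z (dyadic n k.+1) - z (dyadic n k)| <= S * rho ^+ n.

(** Passing from level [n] to [n.+1] appends one binary digit, so the floor either stays or moves to
    the next point of the finer level. *)
Lemma dyadic_step y n : 0 <= y <= 1 ->
  `|z (dyadic_floor n.+1 y) - z (dyadic_floor n y)| <= S * rho ^+ n.+1.
Proof.
move=> y01; have /andP[y0 y1] := y01.
rewrite /dyadic_floor -(dyadic_double n).
have := dyadic_index_le n.+1 y01.
have [->|->] := dyadic_indexS n y0; last exact: zS.
by move=> _; rewrite subrr normr0 mulr_ge0// exprn_ge0// ltW.
Qed.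

Lemma dyadic_tail y n m : 0 <= y <= 1 ->
  `|z (dyadic_floor (n + m) y) - z (dyadic_floor n y)| <=
  S * rho ^+ n.+1 / (1 - rho).
Proof.
move=> y01; have r1 : 0 < 1 - rho by rewrite subr_gt0.
(* The exact partial geometric sum is what the induction on [m] reproduces. *)
apply: (@le_trans _ _ (S * rho ^+ n.+1 * (1 - rho ^+ m) / (1 - rho))); last first.
  rewrite ler_pM2r ?invr_gt0//; apply: ler_piMr.
    by rewrite mulr_ge0// exprn_ge0// ltW.
  by rewrite gerBl exprn_ge0// ltW.
elim: m => [|m IH]; first by rewrite addn0 subrr normr0 expr0 subrr mulr0 mul0r.
rewrite addnS -(subrKA (z (dyadic_floor (n + m) y))).
apply: le_trans (ler_normD _ _) _.
apply: le_trans (lerD (dyadic_step _ y01) IH) _.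
rewrite le_eqVlt; apply/orP; left; apply/eqP.
by rewrite -addSn exprD !exprS; field; rewrite gt_eqF.
Qed.

Lemma dyadic_cvg y : 0 <= y <= 1 -> cvgn (fun n => z (dyadic_floor n y)).
Proof.
move=> y01; rewrite (_ : (fun n => _) =
  (fun n => z (dyadic_floor 0 y) + series (telescope (fun n => z (dyadic_floor n y))) n)).
  apply: is_cvgD; first exact: is_cvg_cst.
  apply: normed_cvg.
  apply: (@series_le_cvg _ _ (geometric (S * rho) rho)).
  - by move=> n; exact: normr_ge0.
  - by move=> n; rewrite /= !mulr_ge0 ?exprn_ge0// ltW.
  - by move=> n /=; rewrite -mulrA -exprS; exact: dyadic_step.
  - by apply: is_cvg_geometric_series; rewrite ger0_norm// ltW.
by apply/funext => n; exact: (eq_sum_telescope (fun n => z (dyadic_floor n y))).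
Qed.

Let l y := limn (fun n => z (dyadic_floor n y)).

Lemma dyadic_lim_tail y n : 0 <= y <= 1 ->
  `|l y - z (dyadic_floor n y)| <= S * rho ^+ n.+1 / (1 - rho).
Proof.
move=> y01; have cv := dyadic_cvg y01.
have cn : `|z (dyadic_floor m y) - z (dyadic_floor n y)| @[m --> \oo] -->
    `|l y - z (dyadic_floor n y)|.
  by apply: cvg_norm; apply: cvgB => //; exact: cvg_cst.
rewrite -(cvg_lim _ cn)//; apply: limr_le; first by apply/cvg_ex; eexists; exact: cn.
near=> m; have nm : (n <= m)%N by near: m; exact: nbhs_infty_ge.
by rewrite -(subnKC nm); exact: dyadic_tail.
Unshelve. all: by end_near. Qed.

Lemma dyadic_close x y n : 0 <= x -> x <= y -> y <= 1 -> y - x <= 2 ^- n ->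
  `|z (dyadic_floor n y) - z (dyadic_floor n x)| <= S * rho ^+ n.
Proof.
move=> x0 xy y1 xyn; have y0 : 0 <= y by exact: le_trans xy.
have y01 : 0 <= y <= 1 by rewrite y0.
have /andP[a1 a2] := dyadic_index_itv n x0.
have /andP[b1 b2] := dyadic_index_itv n y0.
have := dyadic_index_le n y01.
rewrite /dyadic_floor; set i := dyadic_index n x in a1 a2 *.
set j := dyadic_index n y in b1 b2 * => jn.
have ij : (i <= j)%N.
  rewrite -ltnS -(ltr_nat R); apply: le_lt_trans a1 _; apply: le_lt_trans b2.
  by rewrite ler_pM2l.
have ji : (j <= i.+1)%N.
  rewrite -ltnS -(ltr_nat R); apply: le_lt_trans b1 _.
  apply: (@le_lt_trans _ _ (2 ^+ n * x + 1)).
    by rewrite -lerBlDl -mulrBr -ler_pdivlMl// mulr1.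
  by rewrite -[i.+2%:R]natr1 ltrD2r.
move: ji; rewrite leq_eqVlt => /predU1P[ji|].
  by move: jn; rewrite ji; exact: zS.
rewrite ltnS => ji; have -> : j = i by apply/eqP; rewrite eqn_leq ji ij.
by rewrite subrr normr0 mulr_ge0// exprn_ge0// ltW.
Qed.

(** Two tails and one step of level [n] add up to the factor [(1 + rho) / (1 - rho)], rounded up to
    [3 / (1 - rho)]. *)
Lemma dyadic_lim_close x y n : 0 <= x -> x <= y -> y <= 1 -> y - x <= 2 ^- n ->
  `|l y - l x| <= S * (3 / (1 - rho)) * rho ^+ n.
Proof.
move=> x0 xy y1 xyn.
have y01 : 0 <= y <= 1 by rewrite y1 (le_trans x0).
have x01 : 0 <= x <= 1 by rewrite x0 (le_trans xy).
have r1 : 0 < 1 - rho by rewrite subr_gt0.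
have hc := dyadic_close x0 xy y1 xyn.
have hy := dyadic_lim_tail n y01; have hx := dyadic_lim_tail n x01.
set Y := z (dyadic_floor n y) in hc hy; set X := z (dyadic_floor n x) in hc hx.
have -> : l y - l x = (l y - Y) + (Y - X) - (l x - X) by ring.
apply: le_trans (ler_normB _ _) _.
apply: le_trans (lerD (ler_normD _ _) (lexx _)) _.
apply: le_trans (lerD (lerD hy hc) hx) _.
have rn : 0 <= S * rho ^+ n by rewrite mulr_ge0// exprn_ge0// ltW.
have -> : S * rho ^+ n.+1 / (1 - rho) + S * rho ^+ n + S * rho ^+ n.+1 / (1 - rho)
    = (S * rho ^+ n) * ((1 + rho) / (1 - rho)).
  by rewrite exprS; field; rewrite gt_eqF.
have -> : S * (3 / (1 - rho)) * rho ^+ n = (S * rho ^+ n) * (3 / (1 - rho)) by ring.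
by rewrite ler_wpM2l// ler_pM2r ?invr_gt0//; lra.
Qed.

End increments.

Lemma powR_dyadic (b : R) (n : nat) : (2 ^- n) `^ b = (2 `^ (- b)) ^+ n.
Proof.
by rewrite -powR_invn// -powRrM -powR_mulrn ?powR_ge0// -powRrM mulNr mulrC mulNr.
Qed.

Lemma dyadic_scale (d : R) : 0 < d -> d <= 1 ->
  exists n, 2 ^- n.+1 < d /\ d <= 2 ^- n.
Proof.
move=> d0 d1.
have ex : exists n, 2 ^- n.+1 < d.
  have [n _ Hn] : \forall n \near \oo, (2^-1 : R) ^+ n < d.
    have : (2^-1 : R) ^+ n @[n --> \oo] --> (0 : R).
      by apply: cvg_expr; rewrite ger0_norm ?invr_ge0// invf_lt1// ltr1n.
    by move=> /cvgr_lt; apply.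
  by exists n; rewrite -exprVn; apply: Hn => /=.
exists (ex_minn ex); case: ex_minnP => n nd nmin; split => //.
case: n nd nmin => [|n] nd nmin; first by rewrite expr0 invr1.
by rewrite leNgt; apply/negP => /nmin; rewrite ltnn.
Qed.

(** At the scale [2 ^- n.+1 < |y - x| <= 2 ^- n], with rho = 2^(-b), it is [rho ^+ n.+1] that lies
    below |y - x|^b, while the chaining bound has [rho ^+ n]. Hence the additional division by
    rho. *)
Lemma dyadic_lim_holder (z : R -> R) (S b x y : R) : 0 <= S -> 0 < b ->
  (forall n k, (k < 2 ^ n)%N ->
    `|z (dyadic n k.+1) - z (dyadic n k)| <= S * (2 `^ (- b)) ^+ n) ->
  0 <= x <= 1 -> 0 <= y <= 1 ->
  `|limn (fun n => z (dyadic_floor n y)) - limn (fun n => z (dyadic_floor n x))| <=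
  S * (3 / (1 - 2 `^ (- b)) / 2 `^ (- b)) * `|y - x| `^ b.
Proof.
move=> S0 b0 zS x01 y01.
wlog xy : x y x01 y01 / x <= y => [H|].
  case: (leP x y) => [|/ltW] xy; first exact: H.
  by rewrite distrC [`|y - x|]distrC; exact: H.
set rho := 2 `^ (- b).
have rho0 : 0 < rho by exact: powR_gt0.
have rho1 : rho < 1.
  rewrite /rho powRN invf_lt1 ?powR_gt0//.
  have : 1 `^ b < 2 `^ b by rewrite gt0_ltr_powR ?nnegrE// ltr1n.
  by rewrite powR1.
case/andP: x01 => x0 x1; case/andP: y01 => y0 y1.
move: xy; rewrite le_eqVlt => /predU1P[<-|xy].
  by rewrite !subrr normr0 mulr_ge0 ?powR_ge0// mulr_ge0// !divr_ge0 ?subr_ge0// ltW.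
have d0 : 0 < y - x by rewrite subr_gt0.
have d1 : y - x <= 1 by lra.
have [n [nd dn]] := dyadic_scale d0 d1.
apply: le_trans (dyadic_lim_close S0 rho0 rho1 zS x0 (ltW xy) y1 dn) _.
have -> : S * (3 / (1 - rho) / rho) * `|y - x| `^ b =
   S * (3 / (1 - rho)) * (`|y - x| `^ b / rho) by ring.
apply: ler_wpM2l; first by rewrite mulr_ge0// divr_ge0// subr_ge0 ltW.
rewrite ler_pdivlMr// -exprSr -powR_dyadic gtr0_norm//.
by rewrite ge0_ler_powR ?nnegrE ?invr_ge0 ?exprn_ge0// ltW.
Qed.

End dyadic_chaining.

(** * Estimates for the union bound and the Holder constant *)

Section kolmogorov_bounds.
Context {R : realType}.

Lemma expR_le_geometric (n : nat) : expR (- (2 * n%:R)) <= (4 ^+ n)^-1 :> R.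
Proof.
rewrite expRN lef_pV2 ?posrE ?expR_gt0 ?exprn_gt0//.
elim: n => [|n IH]; first by rewrite mulr0 expR0 expr0.
have e2 : 2 <= expR 1 :> R by have := expR_ge1Dx (1 : R); lra.
have e4 : 4 <= expR 2 :> R.
  rewrite (_ : 2 = 1 + 1 :> R)// expRD.
  by apply: le_trans (ler_pM _ _ e2 e2); rewrite ?ler0n//; lra.
rewrite -[n.+1%:R]natr1 mulrDr mulr1 expRD exprS mulrC.
by apply: ler_pM => //; rewrite exprn_ge0.
Qed.

(** The union bound over the [2 ^+ n] increments of level [n]: with [u = 2 * n.+1] the factor
    [expR (- u)] is at most [4 ^- n.+1], which leaves a summable [2 ^- n.+1]. *)
Lemma expR_tail_le (n : nat) :
  2 ^+ n * (2 * expR (1/2 - 2 * n.+1%:R)) <= expR (1/2) / 2 ^+ n.+1 :> R.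
Proof.
rewrite expRD.
have -> : 2 ^+ n * (2 * (expR (1/2) * expR (- (2 * n.+1%:R)))) =
  expR (1/2) * (2 ^+ n.+1 * expR (- (2 * n.+1%:R))) :> R by rewrite exprS; ring.
apply: ler_wpM2l; first exact: expR_ge0.
apply: (@le_trans _ _ (2 ^+ n.+1 * (4 ^+ n.+1)^-1)).
  by rewrite ler_wpM2l ?exprn_ge0// expR_le_geometric.
rewrite (_ : 4 = 2 * 2 :> R); last by ring.
by rewrite exprMn invfM mulrA mulfV ?mul1r// expf_neq0// pnatr_eq0.
Qed.

(** Bernoulli's inequality for the powers of [rho^-1 = 1 + a]. It absorbs the linear factor of the
    chaining thresholds at an arbitrarily small cost in the Holder order. *)
Lemma bounded_linear_geometric (rho : R) : 0 < rho -> rho < 1 ->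
  exists2 M, 0 <= M & forall n : nat, n.+1%:R * rho ^+ n <= M.
Proof.
move=> rho0 rho1; pose a := rho^-1 - 1.
have a0 : 0 < a by rewrite subr_gt0 invf_gt1.
have bern n : 1 + n%:R * a <= rho ^- n.
  rewrite -exprVn (_ : rho^-1 = 1 + a); last by rewrite /a; ring.
  elim: n => [|n IH]; first by rewrite mul0r addr0.
  have na : 0 <= n%:R * a by rewrite mulr_ge0// ltW.
  rewrite exprSr; apply: (@le_trans _ _ ((1 + n%:R * a) * (1 + a))).
    by rewrite -[n.+1%:R]natr1; nra.
  by rewrite ler_wpM2r//; lra.
exists (1 + a^-1) => [|n]; first by rewrite addr_ge0// invr_ge0 ltW.
rewrite -ler_pdivlMr ?exprn_gt0//; apply: le_trans (ler_wpM2l _ (bern n)).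
  have na : 0 <= n%:R * a by rewrite mulr_ge0// ltW.
  have ia : 0 < a^-1 by rewrite invr_gt0.
  have -> : (1 + a^-1) * (1 + n%:R * a) = 1 + n%:R * a + a^-1 + n%:R.
    by field; rewrite gt_eqF.
  by rewrite -[n.+1%:R]natr1; lra.
by rewrite addr_ge0// invr_ge0 ltW.
Qed.

End kolmogorov_bounds.

Section random_variables.
Context d (Omega : measurableType d) {R : realType} (P : probability Omega R).

Lemma random_variable_of (f : Omega -> R) : measurable_fun setT f ->
  exists X : {RV P >-> R}, forall w, X w = f w.
Proof.
move=> mf; pose F := isMeasurableFun.Build _ _ _ _ f mf.
pose X : {RV P >-> R} := HB.pack f F.
by exists X.
Qed.

Lemma borel_cantelli_geometric (F : nat -> set Omega) (M : R) : 0 <= M ->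
  (forall n, measurable (F n)) ->
  (forall n, (P (F n) <= (M / 2 ^+ n.+1)%:E)%E) -> P (lim_sup_set F) = 0%E.
Proof.
move=> M0 mF HF; apply: lim_sup_set_cvg0 => //.
apply: le_lt_trans (ltry M); apply: le_trans (epsilon_trick0 xpredT M0).
apply: lee_nneseries => [n _ //|n _].
by rewrite natrX; exact: HF.
Qed.

Lemma not_lim_sup_set (F : nat -> set Omega) w : ~ lim_sup_set F w ->
  exists N, forall n, (N <= n)%N -> ~ F n w.
Proof.
move=> H; apply: contrapT => /forallNP H'; apply: H => N _.
have /existsNP[n /not_implyP[Nn /contrapT Fn]] := H' N.
by exists n.
Qed.

Lemma measurable_lim_sup_set (F : nat -> set Omega) :
  (forall n, measurable (F n)) -> measurable (lim_sup_set F).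
Proof.
by move=> mF; apply: bigcap_measurable => // k _; exact: bigcup_measurable.
Qed.

End random_variables.

(** * Construction of the modification from exponential tails *)

Section kolmogorov.
Context d (Omega : measurableType d) {R : realType} (P : probability Omega R).
Variables (Z : R -> {RV P >-> R}) (al K : R).
Hypotheses (al0 : 0 < al) (K0 : 0 < K).
Hypothesis tail : forall x y u, 0 <= x -> x < y -> y <= 1 -> 0 < u ->
  (P [set w | (u * K * (y - x) `^ al < `|Z y w - Z x w|)%R] <=
    (2 * expR (1/2 - u))%:E)%E.

(** The tail hypothesis at distance [2 ^- n] with [u = 2 * n.+1]: growth of [u] linear in [n] makes
    the bad events summable and costs nothing in orders strictly below [al]. *)
Let thr (n : nat) : R := 2 * n.+1%:R * K * (2 ^- n) `^ al.

Let pow2_gt0 n : 0 < 2 ^+ n :> R. Proof. exact: exprn_gt0. Qed.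

Let incr (n k : nat) (w : Omega) : R := `|Z (dyadic n k.+1) w - Z (dyadic n k) w|.

Let measurable_incr n k : measurable_fun setT (incr n k).
Proof. by apply: measurableT_comp => //; exact: measurable_funB. Qed.

Let bad (n : nat) : set Omega :=
  \big[setU/set0]_(k < 2 ^ n) [set w | thr n < incr n k w].

Let measurable_bad n : measurable (bad n).
Proof. by apply: bigsetU_measurable => k _; exact: measurable_gt_set. Qed.

Let tail_close x y n : 0 <= x -> x < y -> y <= 1 -> y - x <= 2 ^- n ->
  (P [set w | (thr n < `|Z y w - Z x w|)%R] <=
   (2 * expR (1/2 - 2 * n.+1%:R))%:E)%E.
Proof.
move=> x0 xy y1 yx.
apply: le_trans (tail (u := 2 * n.+1%:R) x0 xy y1 _); last by rewrite mulr_gt0.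
apply: le_measure; rewrite ?inE.
- by apply: measurable_gt_set; apply: measurableT_comp => //; exact: measurable_funB.
- by apply: measurable_gt_set; apply: measurableT_comp => //; exact: measurable_funB.
move=> w /=; apply: le_lt_trans; rewrite /thr ler_wpM2l ?mulr_ge0//; first exact: ltW.
by rewrite ge0_ler_powR ?nnegrE// ?subr_ge0 ?invr_ge0 ltW.
Qed.

Let bad_le n : (P (bad n) <= (expR (1/2) / 2 ^+ n.+1)%:E)%E.
Proof.
apply: (le_trans (@Boole_inequality _ _ _ P
  (fun k => [set w | (thr n < incr n k w)%R]) (2 ^ n) _)).
  by move=> k _; exact: measurable_gt_set.
apply: (@le_trans _ _ (\sum_(k < 2 ^ n) (2 * expR (1/2 - 2 * n.+1%:R))%:E)%E).
  apply: lee_sum => k _; rewrite /incr; apply: tail_close.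
  - by rewrite /dyadic divr_ge0// ltW.
  - by rewrite /dyadic ltr_pM2r ?invr_gt0// ltr_nat.
  - by rewrite /dyadic ler_pdivrMr// mul1r -natrX ler_nat.
  - by rewrite /dyadic -mulrBl -[k.+1%:R]natr1 addrC addKr mul1r.
rewrite sumEFin sumr_const card_ord lee_fin -[X in X <= _]mulr_natl natrX.
exact: expR_tail_le.
Qed.

Let G : set Omega := ~` lim_sup_set bad.

Let mG : measurable G.
Proof. by apply: measurableC; exact: measurable_lim_sup_set. Qed.

Let D (n : nat) (w : Omega) : R := (\big[Num.max/0]_(k < 2 ^ n) incr n k w) * \1_G w.

Let measurable_D n : measurable_fun setT (D n).
Proof.
rewrite /D; apply: measurable_funM; last exact: measurable_indic.
elim: (index_enum _) => [|k s IH].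
  by under eq_fun do rewrite big_nil; exact: measurable_cst.
by under eq_fun do rewrite big_cons; apply: measurable_maxr.
Qed.

Let D_ge0 n w : 0 <= D n w.
Proof.
rewrite /D mulr_ge0//; elim/big_ind: _ => [//|x y x0 y0|k _].
  by rewrite le_max x0.
exact: normr_ge0.
Qed.

(** The process is set to [0] off the good event, as [D] is, so that the path estimates and the
    convergence hold for every [w] and not only almost surely. *)
Let z (w : Omega) (x : R) : R := Z x w * \1_G w.

Let z_incr w n k : (k < 2 ^ n)%N ->
  `|z w (dyadic n k.+1) - z w (dyadic n k)| <= D n w.
Proof.
move=> kn; rewrite /z -mulrBl normrM [X in _ * X]ger0_norm// /D ler_wpM2r//.
exact: (@le_bigmax _ _ _ 0 (fun k : 'I_(2 ^ n) => incr n k w) (Ordinal kn)).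
Qed.

Let D_eventually w : exists N, forall n, (N <= n)%N -> D n w <= thr n.
Proof.
have thr0 n : 0 <= thr n.
  by rewrite /thr !mulr_ge0 ?powR_ge0// ltW.
have [Gw|nGw] := pselect (G w); last first.
  by exists 0%N => n _; rewrite /D indicE memNset// mulr0.
have [N HN] := not_lim_sup_set Gw; exists N => n Nn.
rewrite /D indicE mem_set// mulr1; apply: bigmax_le => // k _.
rewrite leNgt; apply/negP => bk; apply: (HN n Nn).
rewrite /bad -(@bigcup_mkord _ _ (fun k => [set w | thr n < incr n k w])).
by exists k => //=; exact: ltn_ord.
Qed.

Let rho (b : R) : R := 2 `^ (- b).

Let rho_gt0 b : 0 < rho b. Proof. exact: powR_gt0. Qed.

(** Eventually [D n w <= thr n], and [thr n / rho b ^+ n] is [2 * K] times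
    [n.+1%:R * rho (al - b) ^+ n], which is bounded. The finitely many earlier terms, whose number
    depends on [w], are covered by their sum. *)
Let D_bounded b w : 0 < b < al -> exists M, forall n, D n w / rho b ^+ n <= M.
Proof.
move=> /andP[b0 bal].
have [N HN] := D_eventually w.
have rg1 : rho (al - b) < 1.
  rewrite /rho powRN invf_lt1 ?powR_gt0//.
  have : 1 `^ (al - b) < 2 `^ (al - b).
    by rewrite gt0_ltr_powR ?subr_gt0// ?nnegrE// ltr1n.
  by rewrite powR1.
have [M M0 HM] := bounded_linear_geometric (rho_gt0 _) rg1.
have sum0 : 0 <= \sum_(i < N) D i w / rho b ^+ i.
  by apply: sumr_ge0 => i _; rewrite divr_ge0// exprn_ge0// ltW.
exists (2 * K * M + \sum_(i < N) D i w / rho b ^+ i) => n.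
have [nN|Nn] := ltnP n N.
  apply: ler_wpDl; first by rewrite !mulr_ge0// ltW.
  rewrite (bigD1 (Ordinal nN))//= lerDl; apply: sumr_ge0 => i _.
  by rewrite divr_ge0// exprn_ge0// ltW.
apply: ler_wpDr => //.
apply: (@le_trans _ _ (thr n / rho b ^+ n)).
  by rewrite ler_pM2r ?invr_gt0 ?exprn_gt0//; exact: HN.
rewrite /thr powR_dyadic.
have -> : 2 `^ (- al) = rho b * rho (al - b).
  by rewrite /rho -powRD ?pnatr_eq0 ?implybT//; congr (_ `^ _); ring.
rewrite exprMn.
have -> : 2 * n.+1%:R * K * (rho b ^+ n * rho (al - b) ^+ n) / rho b ^+ n =
    2 * K * (n.+1%:R * rho (al - b) ^+ n).
  by field; rewrite expf_neq0// gt_eqF.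
by apply: ler_wpM2l; [rewrite mulr_ge0// ltW|exact: HM].
Qed.

(** The least random constant with [D n w <= S b w * rho b ^+ n]. As a countable supremum it is
    measurable in [w], and [D_bounded] makes it finite. *)
Let S (b : R) (w : Omega) : R := fine (esups (fun n => (D n w / rho b ^+ n)%:E) 0%N).

Let S_spec b w n : 0 < b < al -> D n w <= S b w * rho b ^+ n.
Proof.
move=> bal; have [M HM] := D_bounded w bal.
have ub m : ((D m w / rho b ^+ m)%:E <=
    esups (fun n => (D n w / rho b ^+ n)%:E) 0%N)%E.
  by apply: ereal_sup_ubound; exists m.
have le : (esups (fun n => (D n w / rho b ^+ n)%:E) 0%N <= M%:E)%E.
  by apply: ub_ereal_sup => _ [m _ <-]; rewrite lee_fin.
have fin : esups (fun n => (D n w / rho b ^+ n)%:E) 0%N \is a fin_num.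
  by rewrite fin_numE gt_eqF ?lt_eqF//=; [exact: le_lt_trans le (ltry _)|
    exact: lt_le_trans (ltNyr _) (ub 0%N)].
rewrite -ler_pdivrMr ?exprn_gt0// -lee_fin /S fineK//; exact: ub.
Qed.

Let S_ge0 b w : 0 < b < al -> 0 <= S b w.
Proof.
move=> bal; have := S_spec w 0%N bal; rewrite expr0 mulr1; exact: le_trans.
Qed.

Let measurable_S b : measurable_fun setT (S b).
Proof.
apply: (measurableT_comp (fine_measurable measurableT)).
apply: measurable_fun_esups => n; apply/measurable_EFinP.
by apply: measurable_funM.
Qed.

Let z_S b w n k : 0 < b < al -> (k < 2 ^ n)%N ->
  `|z w (dyadic n k.+1) - z w (dyadic n k)| <= S b w * rho b ^+ n.
Proof. by move=> bal kn; apply: le_trans (z_incr w kn) (S_spec w n bal). Qed.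

Let zt (y : R) (w : Omega) : R :=
  if 0 <= y <= 1 then limn (fun n => z w (dyadic_floor n y)) else 0.

Let zt_cvg y w : 0 <= y <= 1 -> z w (dyadic_floor n y) @[n --> \oo] --> zt y w.
Proof.
move=> y01; rewrite /zt y01.
have bal : 0 < al / 2 < al by rewrite divr_gt0//= ltr_pdivrMr// ltr_pMr// ltr1n.
have r1 : rho (al / 2) < 1.
  rewrite /rho powRN invf_lt1 ?powR_gt0//.
  have : 1 `^ (al / 2) < 2 `^ (al / 2).
    by rewrite gt0_ltr_powR ?divr_gt0// ?nnegrE// ltr1n.
  by rewrite powR1.
exact: (dyadic_cvg (S_ge0 w bal) (rho_gt0 _) r1 (fun n k => @z_S _ w n k bal) y01).
Qed.

Let measurable_zt y : measurable_fun setT (zt y).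
Proof.
have [y01|y01] := boolP (0 <= y <= 1); last first.
  by rewrite /zt (negPf y01); exact: measurable_cst.
apply: (measurable_fun_cvg (h := fun n w => z w (dyadic_floor n y))).
  by move=> n; apply: measurable_funM => //; exact: measurable_indic.
by move=> w _; exact: zt_cvg.
Qed.

Let zt_holder b w x y : 0 < b < al -> 0 <= x <= 1 -> 0 <= y <= 1 ->
  `|zt y w - zt x w| <= S b w * (3 / (1 - rho b) / rho b) * `|y - x| `^ b.
Proof.
move=> bal x01 y01; rewrite /zt x01 y01; have /andP[b0 _] := bal.
exact: (dyadic_lim_holder (S_ge0 w bal) b0 (fun n k => @z_S _ w n k bal)).
Qed.

Let thr_cvg0 : thr n @[n --> \oo] --> 0.
Proof.
have r1 : rho (al / 2) < 1.
  rewrite /rho powRN invf_lt1 ?powR_gt0//.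
  have : 1 `^ (al / 2) < 2 `^ (al / 2).
    by rewrite gt0_ltr_powR ?divr_gt0// ?nnegrE// ltr1n.
  by rewrite powR1.
have [M M0 HM] := bounded_linear_geometric (rho_gt0 _) r1.
apply: (@squeeze_cvgr _ _ _ _ (cst 0) (geometric (2 * K * M) (rho (al / 2)))).
- near=> n; rewrite /thr !mulr_ge0 ?powR_ge0//=; last exact: ltW.
  rewrite powR_dyadic.
  have -> : 2 `^ (- al) = rho (al / 2) * rho (al / 2).
    by rewrite /rho -powRD ?pnatr_eq0 ?implybT//; congr (_ `^ _); field.
  rewrite exprMn.
  have -> : 2 * n.+1%:R * K * (rho (al / 2) ^+ n * rho (al / 2) ^+ n) =
    2 * K * (n.+1%:R * rho (al / 2) ^+ n) * rho (al / 2) ^+ n by ring.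
  rewrite ler_wpM2r ?exprn_ge0//; first exact: ltW.
  by apply: ler_wpM2l; [rewrite mulr_ge0// ltW|exact: HM].
- exact: cvg_cst.
- by apply: cvg_geometric; rewrite ger0_norm// ltW.
Unshelve. all: by end_near. Qed.

Let badat (y : R) (n : nat) : set Omega :=
  [set w | thr n < `|Z y w - Z (dyadic_floor n y) w|].

Let measurable_badat y n : measurable (badat y n).
Proof.
by apply: measurable_gt_set; apply: measurableT_comp => //; exact: measurable_funB.
Qed.

Let badat_le y n : 0 <= y <= 1 -> (P (badat y n) <= (expR (1/2) / 2 ^+ n.+1)%:E)%E.
Proof.
move=> /andP[y0 y1].
have := dyadic_floor_le n y0; rewrite le_eqVlt => /predU1P[yE|yl].
  (* If [y] is its own dyadic floor, [tail] does not apply, as it concerns distinct points, but the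
     event is empty. *)
  rewrite (_ : badat y n = set0) ?measure0 ?lee_fin ?divr_ge0 ?expR_ge0 ?exprn_ge0//.
  apply/seteqP; split => // w; rewrite /badat /= yE subrr normr0 ltNge.
  by rewrite /thr !mulr_ge0 ?powR_ge0// ltW.
apply: le_trans (tail_close (dyadic_floor_ge0 n y) yl y1 _) _.
  exact: ltW (dyadic_floor_gt n y0).
rewrite lee_fin; apply: le_trans (expR_tail_le n).
by rewrite ler_peMl ?mulr_ge0 ?expR_ge0// exprn_ege1// ler1n.
Qed.

(** Outside two null sets the values at the dyadic floors of [y] converge to [zt y] and, since the
    thresholds tend to [0], also to [Z y]. The second null set depends on [y], so this yields a
    modification. *)
Let zt_modification y : 0 <= y <= 1 -> P [set w | Z y w = zt y w] = 1%E.
Proof.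
move=> y01.
have mE : measurable [set w | Z y w = zt y w].
  rewrite (_ : [set w | _] = (fun w => Z y w - zt y w) @^-1` [set 0]).
    rewrite -[X in measurable X]setTI.
    have m : measurable_fun setT (fun w => Z y w - zt y w) by exact: measurable_funB.
    exact: m.
  apply/seteqP; split => w /=; first by move=> ->; rewrite subrr.
  by move/eqP; rewrite subr_eq0 => /eqP.
pose N := lim_sup_set bad `|` lim_sup_set (badat y).
have mN1 : measurable (lim_sup_set bad) by exact: measurable_lim_sup_set.
have mN2 : measurable (lim_sup_set (badat y)) by exact: measurable_lim_sup_set.
have mN : measurable N by exact: measurableU.
have N0 : P N = 0%E.
  apply/eqP; rewrite eq_le measure_ge0 andbT.
  apply: le_trans (measureU2 _ mN1 mN2) _.
  have b1 := borel_cantelli_geometric (expR_ge0 (1/2)) measurable_bad bad_le.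
  have b2 := borel_cantelli_geometric (expR_ge0 (1/2)) (measurable_badat y)
    (fun n => badat_le n y01).
  by rewrite -[X in (_ <= X)%E]adde0; apply: leeD; [rewrite -b1|rewrite -b2].
have sub : ~` N `<=` [set w | Z y w = zt y w].
  move=> w /= /not_orP[Gw Yw].
  have zE x : z w x = Z x w by rewrite /z indicE mem_set// mulr1.
  have c1 : z w (dyadic_floor n y) @[n --> \oo] --> zt y w by exact: zt_cvg.
  have [n0 Hn0] := not_lim_sup_set Yw.
  have c2 : z w (dyadic_floor n y) @[n --> \oo] --> Z y w.
    apply/cvgrPdist_lt => e e0; move/cvgr_lt : thr_cvg0 => /(_ _ e0) thre.
    near=> n; rewrite zE.
    have n0n : (n0 <= n)%N by near: n; exact: nbhs_infty_ge.
    apply: (@le_lt_trans _ _ (thr n)); last by near: n; exact: thre.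
    by rewrite leNgt; apply/negP; exact: Hn0.
  by apply: (cvg_unique _ c2 c1).
have PCN : P (~` N) = 1%E.
  by rewrite probability_setC// N0 sube0.
apply/eqP; rewrite eq_le probability_le1//= -PCN.
by apply: le_measure; rewrite ?inE//; exact: measurableC.
Unshelve. all: by end_near. Qed.

(** [zt] does not involve [b]: one modification serves every order below [al], and only the random
    constant changes. *)
Theorem kolmogorov_chentsov : exists Zt : R -> {RV P >-> R},
  (forall y, 0 <= y <= 1 -> P [set w | Z y w = Zt y w] = 1%E) /\
  (forall b, 0 < b < al -> exists2 C : {RV P >-> R}, (forall w, 0 <= C w) &
    forall w x y, 0 <= x <= 1 -> 0 <= y <= 1 ->
      `|Zt y w - Zt x w| <= C w * `|y - x| `^ b).
Proof.
have /choice[Zt ZtE] y : exists X : {RV P >-> R}, forall w, X w = zt y w.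
  exact: random_variable_of.
exists Zt; split => [y y01|b bal].
  by under eq_set do rewrite ZtE; exact: zt_modification.
have mC : measurable_fun setT (fun w => S b w * (3 / (1 - rho b) / rho b)).
  exact: measurable_funM.
have [C CE] := random_variable_of P mC.
exists C => [w|w x y x01 y01]; last by rewrite !ZtE CE; exact: zt_holder.
have b0 : 0 < b by case/andP: bal.
have r1 : rho b < 1.
  rewrite /rho powRN invf_lt1 ?powR_gt0//.
  have : 1 `^ b < 2 `^ b by rewrite gt0_ltr_powR// ?nnegrE// ltr1n.
  by rewrite powR1.
by rewrite CE mulr_ge0 ?S_ge0// !divr_ge0 ?subr_ge0// ltW.
Qed.

End kolmogorov.

(** * The clock and the modification *)

Section clock.
Context {R : realType}.
Local Notation mu := (@lebesgue_measure R).
Variables (T q lambda C : R) (b : R -> R).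
Hypotheses (T0 : 0 < T) (q1 : 1 <= q) (lambda0 : 0 < lambda).
Hypothesis bL : Lp_on T q%:E b.
Hypothesis bC : forall t, 0 <= t <= T ->
  (Lp_norm_on t q%:E b <= (C * t `^ lambda)%:E)%E.

Let q0 : 0 < q. Proof. exact: lt_le_trans q1. Qed.

Let f (x : R) : R := `|(b \_ `[0, T]) x| `^ q.

Let mpow (g : R -> R) : measurable_fun setT g ->
  measurable_fun [set: R] (fun x => `|g x| `^ q).
Proof.
move=> mg; apply: (measurableT_comp (measurable_powR q)).
exact: measurableT_comp.
Qed.

Let mf : measurable_fun setT f.
Proof. by apply: mpow; exact: Lp_on_measurable bL. Qed.

Let int_f : mu.-integrable `[0, T] (EFin \o f).
Proof.
apply: (integrableS measurableT) => //; apply/integrableP; split.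
  exact/measurable_EFinP.
under eq_integral do rewrite /= ger0_norm ?powR_ge0//.
exact: Lp_on_power_integral_lty q1 bL.
Qed.

Let F1 (t : R) : R := parameterized_integral mu 0 t f.

Let F1E t : t <= T -> F1 t = fine (\int[mu]_x (`|(b \_ `[0%R, t]) x| `^ q)%:E)%E.
Proof.
move=> tT; rewrite /F1 /parameterized_integral /Rintegral integral_mkcond.
congr fine; apply: eq_integral => x _; rewrite /f !patchE /=.
case: ifPn => xt; last by rewrite normr0 powR0// gt_eqF.
by rewrite mem_set//; apply: (sub_itvcc tT); rewrite inE in xt.
Qed.

Let F1_lty t : t <= T -> (\int[mu]_x (`|(b \_ `[0%R, t]) x| `^ q)%:E < +oo)%E.
Proof.
move=> tT.
have [N _ HN] := restrict_power_integral_lt q1 bL (measurable_itv _) (sub_itvcc tT).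
exact: le_lt_trans HN (ltry _).
Qed.

Let F1_incr s t : 0 <= s -> s <= t -> t <= T ->
  (\int[mu]_x (`|(b \_ `]s, t]) x| `^ q)%:E <= (F1 t - F1 s)%:E)%E.
Proof.
move=> s0 st tT; have sT := le_trans st tT.
have mb A : measurable A -> A `<=` `[0, T] ->
    measurable_fun setT (fun x => (`|(b \_ A) x| `^ q)%:E).
  move=> mA AT; apply/measurable_EFinP; apply: mpow.
  exact: measurable_subrestrict bL mA AT.
have p0 A x : [set: R] x -> (0 <= (`|(b \_ A) x| `^ q)%:E)%E.
  by move=> _; rewrite lee_fin powR_ge0.
have I0 A : (0 <= \int[mu]_x (`|(b \_ A) x| `^ q)%:E)%E.
  by apply: integral_ge0 => x; exact: p0.
have F1K u : u <= T -> ((F1 u)%:E = \int[mu]_x (`|(b \_ `[0%R, u]) x| `^ q)%:E)%E.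
  by move=> uT; rewrite F1E// fineK// ge0_fin_numE//; exact: F1_lty.
rewrite EFinB (F1K t tT) (F1K s sT).
have -> : (\int[mu]_x (`|(b \_ `[0%R, t]) x| `^ q)%:E =
    \int[mu]_x (`|(b \_ `[0%R, s]) x| `^ q)%:E +
    \int[mu]_x (`|(b \_ `]s, t]) x| `^ q)%:E)%E.
  rewrite -(ge0_integralD mu measurableT (p0 _) (mb _ _ (sub_itvcc sT)) (p0 _)
    (mb _ _ (sub_itvoc s0 tT)))//.
  apply: eq_integral => x _; rewrite -EFinD; congr EFin; rewrite !patchE.
  have [xs|xs] := leP x s.
    rewrite [X in _ + X](_ : _ = 0) ?addr0; last first.
      by rewrite memNset/= ?in_itv/= ?ltNge ?xs// normr0 powR0// gt_eqF.
    by rewrite !mem_setE !in_itv/= xs (le_trans xs st).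
  rewrite [X in X + _](_ : _ = 0) ?add0r; last first.
    by rewrite memNset/= ?in_itv/= ?[x <= s]leNgt ?xs ?andbF// normr0 powR0// gt_eqF.
  by rewrite !mem_setE !in_itv/= xs (le_trans s0 (ltW xs)).
rewrite addeAC subee ?add0e// ge0_fin_numE//; exact: F1_lty.
Qed.

Let F1_bound t : 0 <= t <= T -> F1 t <= `|C| `^ q * t `^ (lambda * q).
Proof.
move=> t01; have /andP[t0 tT] := t01.
have := bC t01; rewrite /Lp_norm_on => H.
have q00 : q != 0 by rewrite gt_eqF.
pose g := b \_ `[0, t].
(* [C] has no prescribed sign; its absolute value can be raised to the power [q]. *)
have H2 : (Lnorm mu q%:E (EFin \o g) <= (`|C| * t `^ lambda)%:E)%E.
  by apply: le_trans H _; rewrite lee_fin ler_wpM2r ?powR_ge0// ler_norm.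
have I0 : (0 <= \int[mu]_x (`|(b \_ `[0%R, t]) x| `^ q)%:E)%E.
  by apply: integral_ge0 => x _; rewrite lee_fin powR_ge0.
rewrite F1E// -lee_fin fineK ?ge0_fin_numE ?F1_lty//.
have /= <- := @poweR_Lnorm _ _ _ mu (EFin \o g) q q00.
move: H2; have := Lnorm_ge0 mu q%:E (EFin \o g).
case: (Lnorm _ _ _) => [N| |]//; rewrite !lee_fin => N0 NC.
rewrite powRrM -powRM ?powR_ge0//.
by rewrite ge0_ler_powR ?nnegrE ?mulr_ge0 ?powR_ge0// ltW.
Qed.

(* The summand [t ^+ n] only makes the clock strictly increasing. *)
Lemma power_clock : exists (F : R -> R) (c : R),
  [/\ {within `[0, T], continuous F}, F 0 = 0, 0 < c,
    forall s t, 0 <= s -> s < t -> t <= T -> F s < F t /\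
      (\int[mu]_x (`|(b \_ `]s, t]) x| `^ q)%:E <= (F t - F s)%:E)%E &
    forall t, 0 <= t <= T -> F t <= c * t `^ (lambda * q)].
Proof.
(* As [n] exceeds [lambda * q], on [[0, T]] the summand [t ^+ n] is at most T^(n - lambda q)
   t^(lambda q). This is the second term of [c]. *)
pose n := (Num.truncn (lambda * q)).+1.
have lq0 : 0 < lambda * q by exact: mulr_gt0.
have nlq : lambda * q <= n%:R by apply: ltW; exact: truncnS_gt.
pose c := `|C| `^ q + T `^ (n%:R - lambda * q).
exists (fun t => F1 t + t ^+ n), c; split.
- apply: within_continuousD.
    exact: (parameterized_integral_continuous (ltW T0) int_f).
  by apply: continuous_subspaceT; exact: exprn_continuous.
- by rewrite /F1 /parameterized_integral set_itv1 Rintegral_set1 expr0n/= addr0.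
- by rewrite /c ltr_wpDl ?powR_ge0// powR_gt0.
- move=> s t s0 st tT; have H := F1_incr s0 (ltW st) tT.
  have F1st : F1 s <= F1 t.
    rewrite -subr_ge0 -lee_fin; apply: le_trans H.
    by apply: integral_ge0 => x _; rewrite lee_fin powR_ge0.
  have st' : s ^+ n < t ^+ n.
    by rewrite ltrXn2r// ?nnegrE//; exact: le_trans (ltW st).
  split; first by rewrite ler_ltD.
  by apply: le_trans H _; rewrite lee_fin; lra.
- move=> t t01; have /andP[t0 tT] := t01; rewrite /c mulrDl.
  apply: lerD; first exact: F1_bound.
  have [->|tn0] := eqVneq t 0.
    by rewrite expr0n/= mulr_ge0 ?powR_ge0.
  rewrite -powR_mulrn// -{1}(subrK (lambda * q) n%:R) powRD ?tn0 ?implybT//.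
  by rewrite ler_wpM2r ?powR_ge0// ge0_ler_powR ?nnegrE ?subr_ge0// ltW.
Qed.

(** [tau] inverts the clock normalised to [[0, 1]]: it exists by the intermediate value theorem and
    is determined by strict monotonicity. Along [tau] the clock is linear, so its increments become
    distances. *)
Lemma time_change (F : R -> R) :
  {within `[0, T], continuous F} -> F 0 = 0 ->
  (forall s t, 0 <= s -> s < t -> t <= T -> F s < F t) ->
  0 < F T /\ exists tau : R -> R,
  (forall y, 0 <= y <= 1 -> 0 <= tau y <= T /\ F (tau y) = F T * y) /\
  (forall t, 0 <= t <= T -> 0 <= F t / F T <= 1 /\ tau (F t / F T) = t).
Proof.
move=> cF F0 incF; have FT0 : 0 < F T by rewrite -F0; exact: incF.
split=> //.
have ex y : exists t, 0 <= y <= 1 -> 0 <= t <= T /\ F t = F T * y.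
  have [y01|y01] := pselect (0 <= y <= 1); last by exists 0.
  have /andP[y0 y1] := y01.
  have [|t] := IVT (v := F T * y) (ltW T0) cF.
    rewrite F0 (min_l (ltW FT0)) (max_r (ltW FT0)) mulr_ge0//=; last exact: ltW.
    by rewrite ler_piMr// ltW.
  by rewrite in_itv/= => tT Ft; exists t.
have [tau Htau] := choice ex; exists tau; split => // t t01.
have /andP[t0 tT] := t01.
have Ft : 0 <= F t <= F T.
  move: t0 tT; rewrite le_eqVlt => /predU1P[<- _|t0]; first by rewrite F0 lexx ltW.
  rewrite le_eqVlt => /predU1P[->|tT]; first by rewrite lexx ltW.
  rewrite (ltW (incF _ _ (ltW t0) tT (lexx _))) andbT -F0.
  by apply/ltW/incF => //; exact: ltW.
have y01 : 0 <= F t / F T <= 1.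
  by case/andP: Ft => a c; rewrite divr_ge0 ?(ltW FT0)//= ler_pdivrMr// mul1r.
split => //; have [/andP[u0 uT]] := Htau _ y01.
have -> : F T * (F t / F T) = F t by rewrite mulrC divfK ?gt_eqF.
move=> Fu.
have [ut|tu|//] := ltgtP (tau (F t / F T)) t.
  by have := incF _ _ u0 ut tT; rewrite Fu ltxx.
by have := incF _ _ t0 tu uT; rewrite Fu ltxx.
Qed.

End clock.

(** * Return to the original time *)

Lemma within_continuous_holder_comp {R : realType} (T A b : R) (F g : R -> R) :
  0 <= A -> 0 < b ->
  {within `[0, T], continuous F} ->
  (forall t, 0 <= t <= T -> 0 <= F t <= 1) ->
  (forall x y, 0 <= x <= 1 -> 0 <= y <= 1 -> `|g y - g x| <= A * `|y - x| `^ b) ->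
  {within `[0, T], continuous (g \o F)}.
Proof.
move=> A0 b0 /subspace_continuousP cF F01 gH; apply/subspace_continuousP => t tT.
have t01 : 0 <= t <= T by move: tT; rewrite /= in_itv.
have := cF t tT => /cvgrPdist_lt cFt.
apply/cvgrPdist_lt => e e0.
(* [A1] is positive even if [A = 0], and [dl] solves A1 dl^b = e. *)
pose A1 := A + 1.
have A10 : 0 < A1 by rewrite ltr_wpDl.
pose dl := (e / A1) `^ b^-1.
have dl0 : 0 < dl by rewrite powR_gt0// divr_gt0.
have := cFt _ dl0; rewrite !near_withinE => near_dl.
near=> u => uT.
have u01 : 0 <= u <= T by move: uT; rewrite /= in_itv.
have Fu : `|F t - F u| < dl.
  have : `[0, T]%classic u -> `|F t - F u| < dl by near: u; exact: near_dl.
  exact.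
apply: le_lt_trans (gH _ _ (F01 _ u01) (F01 _ t01)) _.
apply: (@le_lt_trans _ _ (A * dl `^ b)).
  by rewrite ler_wpM2l// ge0_ler_powR ?nnegrE ?(ltW b0) ?(ltW dl0)// ltW.
rewrite /dl -powRrM mulVf ?gt_eqF// powRr1; last by rewrite divr_ge0// ltW.
by rewrite mulrA ltr_pdivrMr// mulrC ltr_pM2l// /A1 ltrDl.
Unshelve. all: by end_near. Qed.

Lemma volterra_continuous_modification (d : measure_display)
    (Omega : measurableType d) (R : realType)
    (P : probability Omega R) (T : R) (W : R -> {RV P >-> R})
    (a b c : R -> R) (p : \bar R) (q : R) (r : \bar R) (lambda C : R)
    (X : R -> {RV P >-> R}) :
  0 < T ->
  wiener_process T W ->
  (2%:E <= p)%E -> 1 <= q -> (1 <= r)%E ->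
  (p^-1 + (q%:E)^-1 + r^-1 <= (3 / 2)%:E)%E ->
  Lp_on T p a -> Lp_on T q%:E b -> Lp_on T r c ->
  0 < lambda ->
  (forall t, 0 <= t <= T -> (Lp_norm_on t q%:E b <= (C * t `^ lambda)%:E)%E) ->
  (forall t, 0 <= t <= T ->
     is_wiener_integral W t (volterra_kernel a b c t) (X t)) ->
  exists Xt : R -> {RV P >-> R},
    [/\ modification T X Xt,
        forall w, {within `[0, T], continuous (fun t => Xt t w)}
      & holder_at_zero_up_to T lambda Xt].
Proof.
move=> T0 WW p2 q1 r1 pqr aL bL cL l0 bC XI.
have q0 : 0 < q by exact: lt_le_trans q1.
have [F [c0 [cF F0 c00 incF Fc]]] := power_clock T0 q1 l0 bL bC.
have [FT0 [tau [tauP tauK]]] := time_change T0 cF F0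
  (fun s t s0 st tT => (incF s t s0 st tT).1).
have [K K0 HK] := volterra_kernel_increment T0 p2 q1 r1 pqr aL bL cL.
(* [4] is the loss in [wiener_integral_increment_tail], [Num.sqrt K + 1] is a positive bound for
   [Num.sqrt K], and the power of [F T] accounts for the normalisation of the clock. *)
pose L := 4 * (Num.sqrt K + 1) * F T `^ q^-1.
have sK : 0 <= Num.sqrt K by exact: sqrtr_ge0.
have L0 : 0 < L by rewrite !mulr_gt0 ?powR_gt0// ltr_wpDl.
have qi0 : 0 < q^-1 by rewrite invr_gt0.
pose Z y := X (tau y).
have tail x y u : 0 <= x -> x < y -> y <= 1 -> 0 < u ->
    (P [set w | (u * L * (y - x) `^ q^-1 < `|Z y w - Z x w|)%R] <=
    (2 * expR (1/2 - u))%:E)%E.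
  move=> x0 xy y1 u0.
  have x01 : 0 <= x <= 1 by rewrite x0 (le_trans (ltW xy)).
  have y01 : 0 <= y <= 1 by rewrite y1 (le_trans x0 (ltW xy)).
  have [/andP[s0 sT] Fs] := tauP _ x01; have [/andP[t0 tT] Ft] := tauP _ y01.
  have st : tau x < tau y.
    rewrite ltNge; apply/negP; rewrite le_eqVlt => /predU1P[E|ts].
      move: Ft; rewrite E Fs => /mulfI; rewrite gt_eqF// => /(_ isT) xyE.
      by move: xy; rewrite xyE ltxx.
    have [+ _] := incF _ _ t0 ts sT; rewrite Ft Fs ltr_pM2l//.
    by rewrite ltNge (ltW xy).
  have [_ bst] := incF _ _ s0 st tT.
  have d0 : 0 < F T * (y - x) by rewrite mulr_gt0// subr_gt0.
  (* N^q is the increment of the clock, which dominates the integral of |b|^q over []tau x, tau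
     y]]. *)
  pose N := (F T * (y - x)) `^ q^-1.
  have N0 : 0 < N by exact: powR_gt0.
  have NqE : N `^ q = F (tau y) - F (tau x).
    by rewrite /N -powRrM mulVf ?gt_eqF// powRr1 ?(ltW d0)// Ft Fs mulrBr.
  rewrite -NqE in bst.
  have kst := HK _ _ _ s0 (ltW st) tT N0 bst.
  have sig0 : 0 < (Num.sqrt K + 1) * N by rewrite mulr_gt0// ltr_wpDl.
  have kst' : (\int[@lebesgue_measure R]_v
      (((volterra_kernel a b c (tau y) \_ `[0%R, tau y]) v -
        (volterra_kernel a b c (tau x) \_ `[0%R, tau x]) v) ^+ 2)%:E <=
      (((Num.sqrt K + 1) * N) ^+ 2)%:E)%E.
    apply: le_trans kst _; rewrite lee_fin exprMn ler_wpM2r ?sqr_ge0//.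
    by rewrite -{1}(sqr_sqrtr K0) lerXn2r ?nnegrE ?addr_ge0// lerDl.
  have := wiener_integral_increment_tail WW (ltW T0) sT tT sig0 u0
    (XI _ (tauP _ y01).1) (XI _ (tauP _ x01).1) kst'.
  have -> : u * L * (y - x) `^ q^-1 = 4 * u * ((Num.sqrt K + 1) * N).
    by rewrite /L /N powRM ?(ltW FT0) ?subr_ge0 ?(ltW xy)//; ring.
  exact.
have [Zt [ZtZ ZtH]] := kolmogorov_chentsov qi0 L0 tail.
pose Phi t := F t / F T.
have Phi01 t : 0 <= t <= T -> 0 <= Phi t <= 1 by move=> /tauK[].
have Phi0 : Phi 0 = 0 by rewrite /Phi F0 mul0r.
have cPhi : {within `[0, T], continuous Phi}.
  rewrite (_ : Phi = (fun x => x * (F T)^-1) \o F)//.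
  apply: within_continuous_comp => // x _.
  apply: (@continuousM _ _ id (cst (F T)^-1)); first exact: cvg_id.
  exact: cst_continuous.
exists (fun t => Zt (Phi t)); split.
- move=> t t01; have [y01 tE] := tauK t t01.
  by have := ZtZ _ y01; rewrite /Z tE.
- move=> w.
  (* Any order below [q^-1] gives continuity. *)
  have bq : 0 < q^-1 / 2 < q^-1 by rewrite divr_gt0//= ltr_pdivrMr// ltr_pMr// ltr1n.
  have [D D0 HD] := ZtH _ bq.
  have b0 : 0 < q^-1 / 2 by rewrite divr_gt0.
  apply: (within_continuous_holder_comp (g := fun y => Zt y w) (D0 w) b0 cPhi Phi01).
  by move=> x y x01 y01; exact: HD.
move=> l1 /andP[l10 l1l].
(* Solves [lambda * q * be = l1]; the constraint [be < q^-1] is then [l1 < lambda]. *)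
pose be := l1 / (lambda * q).
have lq0 : 0 < lambda * q by exact: mulr_gt0.
have be0 : 0 < be by exact: divr_gt0.
have bq : 0 < be < q^-1.
  by rewrite be0 /be ltr_pdivrMr//= mulrCA mulVf ?gt_eqF// mulr1.
have [D D0 HD] := ZtH _ bq.
have mC : measurable_fun setT (fun w => D w * (c0 / F T) `^ be).
  exact: measurable_funM.
have [C1 C1E] := random_variable_of P mC.
exists C1 => w t t01; rewrite C1E Phi0.
have /andP[t0 tT] := t01.
have z01 : 0 <= Phi 0 <= 1 by apply: Phi01; rewrite lexx ltW.
rewrite Phi0 in z01.
apply: le_trans (HD w 0 (Phi t) z01 (Phi01 _ t01)) _.
rewrite subr0 -mulrA ler_wpM2l// ger0_norm; last by case/andP: (Phi01 _ t01).
have -> : t `^ l1 = (t `^ (lambda * q)) `^ be.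
  by rewrite -powRrM /be mulrC divfK ?gt_eqF.
rewrite -powRM ?divr_ge0 ?powR_ge0 ?(ltW c00) ?(ltW FT0)//.
rewrite ge0_ler_powR ?nnegrE ?(ltW be0)//.
- by case/andP: (Phi01 _ t01).
- by rewrite mulr_ge0 ?divr_ge0 ?powR_ge0 ?(ltW c00) ?(ltW FT0).
by rewrite /Phi mulrAC ler_pM2r ?invr_gt0//; exact: Fc.
Qed.

Theorem lemma3 (d : measure_display) (Omega : measurableType d) (R : realType)
    (P : probability Omega R) (T : R) (W : R -> {RV P >-> R})
    (a b c : R -> R) (p : \bar R) (q : R) (r : \bar R) (lambda C : R) :
  0 < T ->
  wiener_process T W ->
  (2%:E <= p)%E -> 1 <= q -> (1 <= r)%E ->
  (p^-1 + (q%:E)^-1 + r^-1 <= (3 / 2)%:E)%E ->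
  Lp_on T p a -> Lp_on T q%:E b -> Lp_on T r c ->
  0 < lambda ->
  (forall t, 0 <= t <= T -> (Lp_norm_on t q%:E b <= (C * t `^ lambda)%:E)%E) ->
  (forall t, 0 <= t <= T -> kernel_well_defined a b c t) /\
  (forall X : R -> {RV P >-> R},
    (forall t, 0 <= t <= T ->
       is_wiener_integral W t (volterra_kernel a b c t) (X t)) ->
    exists Xt : R -> {RV P >-> R},
      [/\ modification T X Xt,
          forall w, {within `[0, T], continuous (fun t => Xt t w)}
        & holder_at_zero_up_to T lambda Xt]).
Proof.
move=> T0 WW p2 q1 r1 pqr aL bL cL l0 bC; split=> [t t01|X XI].
  exact: (volterra_kernel_well_defined T0 p2 q1 r1 pqr aL bL cL t01).
exact: (volterra_continuous_modification T0 WW p2 q1 r1 pqr aL bL cL l0 bC XI).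
Qed.
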